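(* Let $\mathcal H$ be a real Hilbert space, $L>0$, $D>0$, $\sigma\ge0$. Let $F:\mathcal H\to\mathcal H$ be monotone and $L$-Lipschitz, $A:\mathcal H\rightrightarrows\mathcal H$ maximally monotone, $z_0\in\mathcal H$, and suppose there is $z_\star$ with $0\in F(z_\star)+A(z_\star)$ and $\|z_0-z_\star\|\le D$. Let $F_\xi(z)=F(z)+\delta_\xi(z)$ be a stochastic oracle with $\mathbb E[\delta_\xi(z)]=0$ and $\mathbb E\|\delta_\xi(z)\|^2\le\sigma^2$ for every $z\in\mathcal H$. Fix an integer $N\ge2$, $a_0\in(0,L)$ and $0<\gamma\le\frac13$ such that $$Q:=Q_{N,\gamma}(a_0):=\frac{\frac{\gamma N}{3}-(L/a_0-1)}{\log(L/a_0)}\ge1 .$$ Run RRSEG for $N$ iterations with parameters $$\eta_k=\frac{1}{3(L+Qa_k)},\qquad a_{k+1}=\min\Bigl\{L,\frac{a_k}{1-\gamma\eta_ka_k}\Bigr\},\qquad \lambda_k=a_{k+1}-a_k .$$ Then $a_N=L$. Moreover, let $$m:=\lfloor\min\{Q,N\}\rfloor,\qquad \overline F_N:=\frac1m\sum_{k=N-m}^{N-1}F_{\xi_k}(z_k),\qquad \widehat z_N:=J_{\frac1LA}\Bigl(z_N-\frac1L\overline F_N\Bigr).$$ Then $$\begin{aligned}\left(\mathbb E[\mathcal R(\widehat z_N)^2]\right)^{1/2}\le{}&\sqrt2LD\left[2\frac{a_0}{L}+\left(\sqrt2-1+\frac{77}{32}\right)\left(\frac{a_0}{L}\right)^2\right]+\frac{\sqrt2\sigma}{\sqrt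 m}\\&+\sigma\sqrt{\frac{5}{2(2-3\gamma)(Q+1)}}\left(\log\frac{L}{a_0}+\sqrt2+\frac94\right).\end{aligned}$$
   Context: $J_{\alpha A}:=(I+\alpha A)^{-1}$ is the resolvent of $A$; $\mathcal R(z):=\operatorname{dist}(0,F(z)+A(z))$. RRSEG: given $a_0>0$, $c_0=z_0$, $\eta_k>0$, $\lambda_k\ge0$, at each iteration $k\ge0$ draw fresh independent samples $\xi_k,\zeta_k$ (independent of each other and of all previous samples) and set $$\begin{aligned}y_k&=J_{\eta_kA}\bigl(z_k-\eta_k(F_{\xi_k}(z_k)+a_k(z_k-c_k))\bigr),\\ z_{k+1}&=y_k-\eta_k\bigl(F_{\zeta_k}(y_k)+a_k(y_k-c_k)-F_{\xi_k}(z_k)-a_k(z_k-c_k)\bigr),\\ a_{k+1}&=a_k+\lambda_k,\qquad c_{k+1}=\frac{a_kc_k+\lambda_kz_{k+1}}{a_{k+1}}.\end{aligned}$$ *)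

(* Defs.v *)
From HB Require Import structures.
From mathcomp Require Import all_boot all_order all_algebra.
From mathcomp Require Import finmap.
From mathcomp Require Import sesquilinear.
From mathcomp Require Import all_classical all_reals all_analysis.

Set Implicit Arguments.
Unset Strict Implicit.
Unset Printing Implicit Defensive.

Import Order.TTheory GRing.Theory Num.Theory.
Import numFieldNormedType.Exports.

Local Open Scope classical_set_scope.
Local Open Scope ring_scope.

(** A real Hilbert space is a complete normed space [H] together with a dot
    product inducing its norm. *)
Definition induces_norm (R : realType) (H : normedModType R)
    (dot : {dot H for idfun}) : Prop :=
  forall x : H, `|x| ^+ 2 = dot x x.

(** A set-valued operator [A : H -> set H] is identified with its graph:
    [A x u] means [u \in A(x)]. *)
Section Operators.
Context {R : realType} {H : normedModType R}.
Implicit Types (dot : {dot H for idfun}) (F : H -> H) (A B : H -> set H).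

Definition monotone_map dot F : Prop :=
  forall x y : H, 0 <= dot (F x - F y) (x - y).

Definition monotone_op dot A : Prop :=
  forall x y u v : H, A x u -> A y v -> 0 <= dot (u - v) (x - y).

Definition maximally_monotone dot A : Prop :=
  monotone_op dot A /\
  forall B, monotone_op dot B -> (forall x, A x `<=` B x) ->
    forall x, B x `<=` A x.

(** The set-valued operator [F + A]. *)
Definition add_op F A : H -> set H := fun z => [set F z + u | u in A z].

(** [(I + alpha A)^-1] as a set-valued operator. *)
Definition resolvent_op A (alpha : R) : H -> set H :=
  fun x => [set y | exists2 u, A y u & x = y + alpha *: u].

(** For maximally monotone [A] and [alpha > 0] the set [resolvent_op A alpha x]
    is a singleton (Minty), so that the default value [0] is irrelevant. *)
Definition resolvent A (alpha : R) (x : H) : H :=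
  xget 0 (resolvent_op A alpha x).

(** [dist(0, F(z) + A(z))]; it is [+oo] when [A z] is empty. *)
Definition residual F A (z : H) : \bar R :=
  ereal_inf [set (`|v|)%:E | v in add_op F A z].

End Operators.

(** Random vectors and their expectation, in the sense of Bochner.  [H] need not
    be separable, hence measurability is strong measurability. *)
Section Bochner.
Context {d : measure_display} {T : measurableType d} {R : realType}
  {H : normedModType R}.

Definition vsimple (s : T -> H) : Prop :=
  finite_set (range s) /\ forall v : H, measurable (s @^-1` [set v]).

Definition strongly_measurable (X : T -> H) : Prop :=
  exists s : nat -> T -> H,
    (forall n, vsimple (s n)) /\ (forall t, s ^~ t @ \oo --> X t).

Definition vsimple_expectation (P : probability T R) (s : T -> H) : H :=
  \sum_(v \in range s) fine (P (s @^-1` [set v])) *: v.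

Definition has_expectation (P : probability T R) (X : T -> H) (e : H) : Prop :=
  strongly_measurable X /\
  exists s : nat -> T -> H,
    [/\ forall n, vsimple (s n),
        (fun n => \int[P]_t (`|X t - s n t|)%:E)%E @ \oo --> 0%E
      & (fun n => vsimple_expectation P (s n)) @ \oo --> e].

End Bochner.

(** Measurability of a random map [delta_x : H -> H]: substituting an
    (independent) random vector for the argument yields a random vector.  For
    separable [H] this is joint measurability of [delta]; for nonseparable [H]
    joint Borel measurability is not enough, since sums of Borel maps into [H]
    need not be Borel. *)
Definition measurable_random_map {dX : measure_display} {X : measurableType dX}
    {R : realType} {H : normedModType R} (delta : X -> H -> H) : Prop :=
  forall (d : measure_display) (T : measurableType d) (Z : T -> H),
    strongly_measurable Z ->
    strongly_measurable (fun p : X * T => delta p.1 (Z p.2)).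

Definition mutually_independent {d d' : measure_display} {T : measurableType d}
    {T' : measurableType d'} {R : realType} (P : probability T R)
    {I : choiceType} (X : I -> {RV P >-> T'}) : Prop :=
  forall (J : {fset I}) (B : I -> set T'), (forall i, measurable (B i)) ->
    P (\bigcap_(i in [set` J]) (X i @^-1` B i)) =
    (\prod_(i <- J) P (X i @^-1` B i))%E.

(** The triple [(a_k, z_k, c_k)] of RRSEG after [k] iterations, for the oracle
    [G x z = F_x(z)] and given realizations [x k], [t k] of the samples
    [xi_k], [zeta_k]. *)
Fixpoint rrseg {R : realType} {H : normedModType R} {X : Type}
    (A : H -> set H) (G : X -> H -> H) (z0 : H) (a0 : R) (eta lambda : nat -> R)
    (x t : nat -> X) (k : nat) : R * H * H :=
  if k is j.+1 then
    let: (a, z, c) := rrseg A G z0 a0 eta lambda x t j in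
    let y := resolvent A (eta j)
      (z - eta j *: (G (x j) z + a *: (z - c))) in
    let z' := y - eta j *:
      (G (t j) y + a *: (y - c) - G (x j) z - a *: (z - c)) in
    let a' := a + lambda j in
    (a', z', a'^-1 *: (a *: c + lambda j *: z'))
  else (a0, z0, z0).

Definition rrseg_z {R : realType} {H : normedModType R} {X : Type}
    (A : H -> set H) (G : X -> H -> H) (z0 : H) (a0 : R) (eta lambda : nat -> R)
    (x t : nat -> X) (k : nat) : H :=
  (rrseg A G z0 a0 eta lambda x t k).1.2.

Definition Qparam {R : realType} (L gamma : R) (N : nat) (a0 : R) : R :=
  (gamma * N%:R / 3 - (L / a0 - 1)) / ln (L / a0).

(* Main.v *)
(** Let [u_k] be the solution of the regularized inclusion
    [0 \in F(u) + a_k (u - c_k) + A(u)].  One stochastic step contracts towards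
    [u_k]: the sample [zeta_k] is independent of everything before it, so its
    noise enters the mean square orthogonally, and
    [E|z_(k+1) - u_k|^2 <= (1 - 4/3 eta_k a_k) E|z_k - u_k|^2 + 5/2 eta_k^2 sigma^2].
    Since [a_k / a_(k+1) >= 1 - gamma eta_k a_k], this yields
    [|z_k - u_k| <= (a_0/a_k)^2 D + kappa/a_k] in mean square, with [kappa^2] equal
    to [5 sigma^2 / (4 (2 - 3 gamma) (Q + 1))].  The update of [c_k] amounts to
    adding [lambda_k (u - z_(k+1))] to the inclusion, so that
    [|u_(k+1) - z_(k+1)| <= |u_k - z_(k+1)|] and
    [a_(k+1) |u_(k+1) - c_(k+1)| <= a_k |u_k - c_k| + lambda_k |u_k - z_(k+1)|];
    summing, [L |u_N - c_N|] is controlled by [2 a_0 D].  The residual at the output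
    is at most [sqrt 2 L] times [|u_N - c_N|] plus the distance between
    [z_N - Fbar/L] and [u_N - F(u_N)/L].  Over the last [m <= Q] iterations [a_k]
    stays above [8/9 L], which bounds the drift [z_k - z_N] in the average [Fbar].

    Minty's theorem provides the resolvents: the Fitzpatrick function of [A] plus
    half the squared norm has a minimizer [(x, u)], and optimality forces
    [u = - x] and [- x \in A(x)]. *)

Require Import Defs.
From HB Require Import structures.
From mathcomp Require Import all_boot all_order all_algebra.
From mathcomp Require Import finmap.
From mathcomp Require Import sesquilinear.
From mathcomp Require Import all_classical all_reals all_analysis.
From mathcomp Require Import measurable_realfun ring lra.

Set Implicit Arguments.
Unset Strict Implicit.
Unset Printing Implicit Defensive.

Import Order.TTheory GRing.Theory Num.Theory.
Import numFieldNormedType.Exports.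

Local Open Scope classical_set_scope.
Local Open Scope ring_scope.

(** * Monotone operators in Hilbert spaces *)

Section InnerProduct.
Context {R : realType} {H : normedModType R} (dot : {dot H for idfun}).
Hypothesis hdot : induces_norm dot.
Implicit Types x y z : H.

Lemma dotDl x y z : dot (x + y) z = dot x z + dot y z.
Proof. exact: linearDl. Qed.

Lemma dotDr x y z : dot z (x + y) = dot z x + dot z y.
Proof. exact: linearDr. Qed.

Lemma dotNl x z : dot (- x) z = - dot x z.
Proof. exact: linearNl. Qed.

Lemma dotNr x z : dot z (- x) = - dot z x.
Proof. exact: linearNr. Qed.

Lemma dotZl a x z : dot (a *: x) z = a * dot x z.
Proof. exact: linearZl_LR. Qed.

Lemma dotZr a x z : dot z (a *: x) = a * dot z x.
Proof. exact: linearZr_LR. Qed.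

Lemma dot0l x : dot 0 x = 0.
Proof. exact: linear0l. Qed.

Lemma dot0r x : dot x 0 = 0.
Proof. exact: linear0r. Qed.

Lemma dotC x y : dot x y = dot y x.
Proof. by rewrite (@hermC _ _ _ _ dot) expr0 mul1r. Qed.

Definition dotE := (dotDl, dotDr, dotNl, dotNr, dotZl, dotZr).

Lemma dot_ge0 x : 0 <= dot x x.
Proof. by rewrite -hdot sqr_ge0. Qed.

Lemma norm_le_sqr x (c : R) : 0 <= c -> dot x x <= c ^+ 2 -> `|x| <= c.
Proof. by move=> c0; rewrite -hdot ler_pXn2r ?nnegrE. Qed.

Lemma dot_ext x y : (forall w, dot x w = dot y w) -> x = y.
Proof.
move=> xy; apply/eqP; rewrite -subr_eq0 -normr_eq0 -sqrf_eq0 hdot.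
by rewrite dotDl dotNl xy subrr.
Qed.

Lemma CauchySchwarz_dot x y : `|dot x y| <= `|x| * `|y|.
Proof.
have [->|y0] := eqVneq y 0; first by rewrite dot0r !normr0 mulr0.
have ny2 : 0 < dot y y by rewrite -hdot exprn_gt0// normr_gt0.
rewrite -(@ler_pXn2r _ 2) ?nnegrE ?mulr_ge0// exprMn !hdot real_normK ?num_real//.
rewrite -subr_ge0 -(pmulr_rge0 _ ny2).
have := dot_ge0 (dot y y *: x - dot x y *: y).
by rewrite !dotE (dotC y x); nra.
Qed.

Lemma dot_cvgl (f : nat -> H) x y : f @ \oo --> x ->
  (fun n => dot (f n) y) @ \oo --> dot x y.
Proof.
move=> fx.
have E z : dot z y = 2^-1 * (`|z + y| ^+ 2 - `|z| ^+ 2 - `|y| ^+ 2).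
  by rewrite !hdot !dotE (dotC y z); field.
rewrite (_ : (fun n => _) =
  (fun n => 2^-1 * (`|f n + y| ^+ 2 - `|f n| ^+ 2 - `|y| ^+ 2))); last first.
  by apply/funext => n; exact: E.
rewrite E; apply: cvgMl_tmp; apply: cvgB; last exact: cvg_cst.
have fy : (fun n => `|f n + y|) @ \oo --> `|x + y|.
  by apply: cvg_norm; apply: cvgD => //; exact: cvg_cst.
by apply: cvgB; apply: cvgM => //; exact: cvg_norm.
Qed.

Lemma normsq_cvg (f : nat -> H) x : f @ \oo --> x ->
  (fun n => dot (f n) (f n)) @ \oo --> dot x x.
Proof.
move=> fx; rewrite -hdot; under eq_fun do rewrite -hdot.
by apply: cvgM; exact: cvg_norm.
Qed.

Section MaximalMonotone.
Variable A : H -> set H.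
Hypothesis hA : maximally_monotone dot A.

(** Adjoining the pair [(x, u)] to the graph keeps it monotone, so maximality says that the graph
    already contains it. *)
Lemma maximally_monotone_mem x u :
  (forall y v, A y v -> 0 <= dot (u - v) (x - y)) -> A x u.
Proof.
move=> xu; have [mA maxA] := hA.
apply: (maxA (fun x' u' => A x' u' \/ (x' = x /\ u' = u))); last by right.
- move=> y z v w [Ayv|[-> ->]] [Azw|[-> ->]].
  + exact: mA.
  + by have := xu _ _ Ayv; rewrite !dotE; nra.
  + exact: xu.
  + by rewrite !subrr dot0l.
- by move=> y v; left.
Qed.

Lemma maximally_monotone_nonempty : exists x u, A x u.
Proof.
apply: contrapT => nA; apply: (nA); exists 0, 0.
by apply: maximally_monotone_mem => y v Ayv; exfalso; apply: nA; exists y, v.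
Qed.

End MaximalMonotone.

End InnerProduct.

(* Identities between linear combinations become ring identities after pairing
   with an arbitrary vector. *)
Ltac vector_ring hdot :=
  apply: (dot_ext hdot) => ?; rewrite !(dotE, dot0l); ring.

(** * Minty's theorem through the Fitzpatrick function *)

Section Minty.
Context {R : realType} {H : completeNormedModType R} (dot : {dot H for idfun}).
Hypothesis hdot : induces_norm dot.
Variable A : H -> set H.
Hypothesis hA : maximally_monotone dot A.

(* The epigraph of the Fitzpatrick function of [A]. *)
Let epi x u t := forall y v, A y v -> dot x v + dot y u - dot y v <= t.
Let cost x u t := t + (dot x x + dot u u) / 2.

Let epi_graph x u : A x u -> epi x u (dot x u).
Proof.
move=> Axu y v Ayv; have := hA.1 _ _ _ _ Axu Ayv.
by rewrite !dotE (dotC dot u x) (dotC dot v x) (dotC dot v y) (dotC dot u y); lra.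
Qed.

(** If [t] were smaller than [dot x u], the pair [(x, u)] would be monotonically related to the
    whole graph, hence lie in it; testing [epi] against [(x, u)] itself would then give
    [dot x u <= t]. *)
Let epi_ge x u t : epi x u t -> dot x u <= t.
Proof.
move=> e; rewrite leNgt; apply/negP => tu.
suff /e : A x u by rewrite addrK; lra.
apply: (maximally_monotone_mem hA) => y v /e.
by rewrite !dotE (dotC dot u x) (dotC dot v x) (dotC dot v y) (dotC dot u y); lra.
Qed.

Let cost_ge x u t : epi x u t -> dot (x + u) (x + u) / 2 <= cost x u t.
Proof. by move=> /epi_ge; rewrite /cost !dotE (dotC dot u x); lra. Qed.

Let epi_conv s x u t x' u' t' : 0 <= s <= 1 -> epi x u t -> epi x' u' t' ->
  epi (x + s *: (x' - x)) (u + s *: (u' - u)) (t + s * (t' - t)).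
Proof.
move=> /andP[s0 s1] e e' y v Ayv; have {}e := e _ _ Ayv.
have {}e' := e' _ _ Ayv.
rewrite !dotE; nra.
Qed.

Let cost_conv s x u t x' u' t' :
  cost (x + s *: (x' - x)) (u + s *: (u' - u)) (t + s * (t' - t)) =
  cost x u t + s * (t' - t + dot x (x' - x) + dot u (u' - u)) +
  s ^+ 2 * ((dot (x' - x) (x' - x) + dot (u' - u) (u' - u)) / 2).
Proof.
rewrite /cost.
move: (x' - x) (u' - u) => y v.
by rewrite !dotE (dotC dot y x) (dotC dot v u); field.
Qed.

Let V := [set c | exists x u t, epi x u t /\ c = cost x u t].

Let has_inf_V : has_inf V.
Proof.
split.
  have [x [u Axu]] := maximally_monotone_nonempty hA.
  by exists (cost x u (dot x u)); exists x, u, (dot x u); split => //; exact: epi_graph.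
exists 0 => c [x [u [t [/cost_ge h ->]]]]; apply: le_trans h.
by rewrite divr_ge0// (dot_ge0 hdot).
Qed.

Let inf_le x u t : epi x u t -> inf V <= cost x u t.
Proof. by move=> e; apply: ge_inf; [exact: has_inf_V.2|exists x, u, t]. Qed.

(** Strong convexity: the midpoint of two near-minimizers is feasible, so its cost is at least
    [inf V], and the quadratic part of [cost] then forces the two points to be close. *)
Let cost_gap x u t x' u' t' e e' : epi x u t -> epi x' u' t' ->
  cost x u t <= inf V + e -> cost x' u' t' <= inf V + e' ->
  dot (x' - x) (x' - x) + dot (u' - u) (u' - u) <= 4 * (e + e').
Proof.
move=> p p' ce ce'.
have s01 : 0 <= (2^-1 : R) <= 1 by lra.
have := inf_le (epi_conv s01 p p').
rewrite cost_conv; move: ce'.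
have -> : cost x' u' t' = cost x u t + (t' - t + dot x (x' - x) + dot u (u' - u))
  + ((dot (x' - x) (x' - x) + dot (u' - u) (u' - u)) / 2).
  by have := cost_conv 1 x u t x' u' t'; rewrite !scale1r !mul1r expr1n !mul1r !subrKC.
by lra.
Qed.

Let exists_minimizer : exists x u t, epi x u t /\ cost x u t = inf V.
Proof.
have /choice[f Hf] : forall n : nat, exists p : H * H * R,
    epi p.1.1 p.1.2 p.2 /\ cost p.1.1 p.1.2 p.2 <= inf V + n.+1%:R^-1.
  move=> n; have n0 : 0 < (n.+1%:R^-1 : R) by rewrite invr_gt0.
  have [c [x [u [t [e ->]]]] lt] := inf_adherent n0 has_inf_V.
  by exists (x, u, t); split => //; exact: ltW.
pose x n := (f n).1.1; pose u n := (f n).1.2; pose t n := (f n).2.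
have gap n m : dot (x m - x n) (x m - x n) + dot (u m - u n) (u m - u n) <=
    4 * (n.+1%:R^-1 + m.+1%:R^-1).
  by have [en cn] := Hf n; have [em cm] := Hf m; exact: cost_gap en em cn cm.
have cauchy (g : nat -> H) : (forall n m, dot (g m - g n) (g m - g n) <=
    4 * (n.+1%:R^-1 + m.+1%:R^-1)) -> cvgn g.
  move=> hg; apply/cauchy_cvgP/cauchy_exP => e e0.
  have e2 : 0 < 8 / e ^+ 2 by rewrite divr_gt0 ?exprn_gt0.
  pose n := Num.bound (8 / e ^+ 2).
  have ne : n.+1%:R^-1 * 8 < e ^+ 2.
    rewrite mulrC ltr_pdivrMr// -ltr_pdivrMl ?exprn_gt0// mulrC.
    by apply: lt_le_trans (archi_boundP (ltW e2)) _; rewrite ler_nat.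
  exists (g n), n => // m /= nm.
  rewrite -ball_normE /ball_ /= distrC -(@ltr_pXn2r _ 2) ?nnegrE// ?(ltW e0)//.
  rewrite hdot; apply: le_lt_trans ne.
  apply: le_trans (hg n m) _.
  have : (m.+1%:R^-1 : R) <= n.+1%:R^-1 by rewrite lef_pV2 ?posrE// ler_nat ltnS.
  move: (n.+1%:R^-1) (m.+1%:R^-1) => p q.
  by lra.
have /cvg_ex[x0 cx] : cvgn x.
  by apply: cauchy => n m; apply: le_trans (gap n m); rewrite lerDl (dot_ge0 hdot).
have /cvg_ex[u0 cu] : cvgn u.
  by apply: cauchy => n m; apply: le_trans (gap n m); rewrite lerDr (dot_ge0 hdot).
(* The third component is not a limit of [t n] but the value that makes the cost equal to [inf V];
   what remains is to pass to the limit in each inequality defining [epi]. *)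
exists x0, u0, (inf V - (dot x0 x0 + dot u0 u0) / 2); split; last first.
  by rewrite /cost subrK.
move=> y v Ayv.
rewrite lerBrDr.
have lhs : (fun n => dot (x n) v + dot (u n) y - dot y v +
    (dot (x n) (x n) + dot (u n) (u n)) / 2) @ \oo -->
    dot x0 v + dot y u0 - dot y v + (dot x0 x0 + dot u0 u0) / 2.
  rewrite (dotC dot y u0).
  apply: cvgD; last by apply: cvgMr_tmp; apply: cvgD; exact: (normsq_cvg hdot).
  by apply: cvgB; [apply: cvgD; exact: (dot_cvgl hdot)|exact: cvg_cst].
have rhs : (fun n => inf V + n.+1%:R^-1) @ \oo --> inf V.
  rewrite -[X in _ --> X]addr0; apply: cvgD; first exact: cvg_cst.
  exact: cvg_harmonic.
apply: ler_cvg_to lhs rhs _; apply: nearW => n.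
have [/(_ _ _ Ayv) en cn] := Hf n.
apply: le_trans cn; rewrite /cost lerD2r.
by rewrite (dotC dot (u n)).
Qed.

Lemma Minty0 : exists x, A x (- x).
Proof.
have [x [u [t [e cI]]]] := exists_minimizer.
(* First-order optimality in the direction of a graph point, which is feasible with [t = dot y v] by
   [epi_graph]. *)
have opt y v : A y v ->
    0 <= dot y v - t + dot x (y - x) + dot u (v - u).
  move=> Ayv; set p := (X in 0 <= X).
  pose q := dot (y - x) (y - x) + dot (v - u) (v - u).
  have q0 : 0 <= q by rewrite addr_ge0// (dot_ge0 hdot).
  rewrite leNgt; apply/negP => p0.
  (* A step [s] changes the cost by [s * p + s ^+ 2 * q / 2], which is negative as soon as
     [s * (q + 1) <= - p]. *)
  pose s := Num.min 1 (- p / (q + 1)).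
  have s0 : 0 < s by rewrite lt_min ltr01 divr_gt0//; lra.
  have s1 : s <= 1 by rewrite ge_min lexx.
  have sq : s * (q + 1) <= - p.
    by rewrite -ler_pdivlMr; [rewrite ge_min lexx orbT | lra].
  have := inf_le (@epi_conv s _ _ _ _ _ _ _ e (epi_graph Ayv)).
  rewrite cost_conv cI -/p -/q.
  move=> /(_ _)/wrap[]; first by rewrite ltW.
  nra.
have key y v : A y v -> dot (x + u) (x + u) <= dot (y + u) (v + x).
  move=> /opt; have := epi_ge e.
  by rewrite !dotE (dotC dot u x) (dotC dot y x); lra.
(* By [key], [(- u, - x)] is monotonically related to the graph, hence in it; applying [key] to this
   very point makes its right-hand side vanish and yields [u = - x]. *)
have Aux : A (- u) (- x).
  apply: (maximally_monotone_mem hA) => y v /key h.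
  have := dot_ge0 hdot (x + u).
  by move: h; rewrite !dotE (dotC dot u x) (dotC dot v y) (dotC dot x y)
     (dotC dot v u); lra.
exists (- u); rewrite opprK.
suff ux : u = - x by rewrite {2}ux.
apply/eqP; rewrite -addr_eq0 (addrC u) -normr_eq0 -sqrf_eq0 hdot eq_le (dot_ge0 hdot) andbT.
by have := key _ _ Aux; rewrite addNr dot0l.
Qed.

End Minty.

(** * Resolvents and regularized inclusions *)

Section Resolvent.
Context {R : realType} {H : completeNormedModType R} (dot : {dot H for idfun}).
Hypothesis hdot : induces_norm dot.

(** The common last step of the distance estimates below: monotonicity delivers an obtuse angle, and
    expanding the square of [p - q] turns it into a comparison of norms. *)
Lemma norm_le_of_dot_le0 (p q : H) : dot p (p - q) <= 0 -> `|p| <= `|q|.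
Proof.
move=> pq; rewrite -(@ler_pXn2r _ 2) ?nnegrE// !hdot.
have := dot_ge0 hdot (p - q).
by move: pq; rewrite !dotE (dotC dot q p); lra.
Qed.

Section Operators.
Variables (A : H -> set H) (hA : maximally_monotone dot A).

Lemma resolvent_graph alpha x : 0 < alpha ->
  A (resolvent A alpha x) (alpha^-1 *: (x - resolvent A alpha x)).
Proof.
move=> al0.
(* Minty's theorem at the origin is applied to [w |-> alpha A(w + x)], which inherits maximal
   monotonicity; a point [w] with [- w] in its image gives the resolvent value [w + x]. *)
have mB : maximally_monotone dot (fun w => [set v | A (w + x) (alpha^-1 *: v)]).
  split.
    move=> w w' v v' /= h h'; have := hA.1 _ _ _ _ h h'.
    rewrite -scalerBr dotZl pmulr_rge0 ?invr_gt0//.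
    by rewrite opprD addrACA subrr addr0.
  move=> B mB AB w v Bwv /=.
  apply: (maximally_monotone_mem hA) => y u Ayu.
  have Byu : B (y - x) (alpha *: u).
    by apply: AB; rewrite /= subrK scalerA mulVf ?scale1r ?gt_eqF.
  have := mB _ _ _ _ Bwv Byu; rewrite opprB addrA => h.
  by rewrite -(pmulr_rge0 _ al0) -dotZl scalerBr !scalerA mulfV ?gt_eqF// scale1r.
have [w /= Aw] := Minty0 hdot mB.
have ex : resolvent_op A alpha x (w + x).
  exists (alpha^-1 *: - w) => //.
  by rewrite scalerA mulfV ?gt_eqF// scale1r addrAC subrr add0r.
have := @xgetI _ 0 _ _ ex; rewrite -/(resolvent A alpha x) => -[u Au xE].
by rewrite {2}xE addrAC subrr add0r scalerA mulVf ?gt_eqF// scale1r.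
Qed.

Lemma resolvent_firm alpha x y : 0 < alpha ->
  0 <= dot (x - y - (resolvent A alpha x - resolvent A alpha y))
           (resolvent A alpha x - resolvent A alpha y).
Proof.
move=> al0; have := hA.1 _ _ _ _ (resolvent_graph x al0) (resolvent_graph y al0).
rewrite -scalerBr dotZl pmulr_rge0 ?invr_gt0//.
move: (resolvent A alpha x) (resolvent A alpha y) => p q.
by rewrite (_ : x - p - (y - q) = x - y - (p - q)); last by vector_ring hdot.
Qed.

Lemma resolvent_nonexpansive alpha x y : 0 < alpha ->
  `|resolvent A alpha x - resolvent A alpha y| <= `|x - y|.
Proof.
move=> al0; apply: norm_le_of_dot_le0.
by rewrite dotC -opprB dotNl oppr_le0 resolvent_firm.
Qed.

Section Regularized.
Variables (F : H -> H) (L : R).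
Implicit Types (a : R) (c : H).
Hypothesis hL : 0 < L.
Hypothesis hFmono : monotone_map dot F.
Hypothesis hFlip : forall x y, `|F x - F y| <= L * `|x - y|.

Definition regularized (a : R) (c z : H) : H := F z + a *: (z - c).

Lemma regularized_strongly_monotone a c x y :
  a * dot (x - y) (x - y) <= dot (regularized a c x - regularized a c y) (x - y).
Proof.
have -> : regularized a c x - regularized a c y = F x - F y + a *: (x - y).
  by rewrite /regularized; vector_ring hdot.
by rewrite [leRHS]dotDl dotZl lerDr hFmono.
Qed.

Lemma regularized_lipschitz a c x y : 0 <= a ->
  `|regularized a c x - regularized a c y| <= (L + a) * `|x - y|.
Proof.
move=> a0; have -> : regularized a c x - regularized a c y = F x - F y + a *: (x - y).
  by rewrite /regularized; vector_ring hdot.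
by rewrite (le_trans (ler_normD _ _))// mulrDl lerD// normrZ ger0_norm.
Qed.

Definition regularized_solution (a : R) (c : H) : H :=
  xget 0 [set u | A u (- regularized a c u)].

(** A solution is a fixed point of [z |-> J_eta(z - eta B z)], which is a contraction because [B] is
    strongly monotone and Lipschitz. In particular the default value [0] of [regularized_solution]
    is never taken. *)
Lemma regularized_solution_graph a c : 0 < a ->
  A (regularized_solution a c) (- regularized a c (regularized_solution a c)).
Proof.
move=> a0; set B := regularized a c.
suff [p Ap] : exists p, A p (- B p).
  exact: (@xgetI _ 0 [set u | A u (- B u)] p).
pose l := L + a; have l0 : 0 < l by rewrite addr_gt0.
(* This step minimizes the squared contraction factor [1 - 2 eta a + eta^2 l^2], whose value becomes
   [1 - a^2 / l^2]. *)
pose eta := a / l ^+ 2; have eta0 : 0 < eta by rewrite divr_gt0 ?exprn_gt0.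
pose T z := resolvent A eta (z - eta *: B z).
have q01 : 0 <= 1 - a ^+ 2 / l ^+ 2 < 1.
  rewrite subr_ge0 gtrBl divr_gt0 ?exprn_gt0// andbT.
  by rewrite ler_pdivrMr ?exprn_gt0// mul1r ler_pXn2r ?nnegrE ?lerDr// ltW.
pose q := Num.sqrt (1 - a ^+ 2 / l ^+ 2).
have q1 : q < 1 by rewrite -sqrtr1 ltr_sqrt// (andP q01).2.
have Tlip x y : `|T x - T y| <= q * `|x - y|.
  apply: le_trans (resolvent_nonexpansive _ _ eta0) _.
  apply: (norm_le_sqr hdot); first by rewrite mulr_ge0 ?sqrtr_ge0.
  rewrite exprMn sqr_sqrtr ?(andP q01).1// hdot.
  have -> : x - eta *: B x - (y - eta *: B y) = (x - y) - eta *: (B x - B y).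
    by vector_ring hdot.
  have m := regularized_strongly_monotone a c x y; rewrite -/B in m.
  have : dot (B x - B y) (B x - B y) <= l ^+ 2 * dot (x - y) (x - y).
    by rewrite -!hdot -exprMn ler_pXn2r ?nnegrE ?mulr_ge0// ?(ltW l0)//;
       apply: regularized_lipschitz; exact: ltW.
  move: m; move: (B x - B y) (x - y) => b d m lip.
  rewrite !dotE (dotC dot d b).
  have e1 : eta * l ^+ 2 = a by rewrite divfK// gt_eqF// exprn_gt0.
  have e2 : a ^+ 2 / l ^+ 2 = eta * a by rewrite /eta; ring.
  rewrite e2.
  have h1 := ler_wpM2l (ltW eta0) m.
  have h2 := ler_wpM2l (ltW eta0) (ler_wpM2l (ltW eta0) lip).
  rewrite (_ : eta * (eta * (l ^+ 2 * dot d d)) = eta * (a * dot d d)) in h2; last first.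
    by rewrite -e1; ring.
  lra.
pose Tf : {fun [set: H] >-> [set: H]} := totalfun T.
have ctr : is_contraction Tf.
  exists (NngNum (sqrtr_ge0 _ : 0 <= q)); split => //= -[x y] _ /=.
  exact: Tlip.
have [p _ pT] := banach_fixed_point ctr closedT (ex_intro _ 0 Logic.I).
exists p; have := resolvent_graph (p - eta *: B p) eta0.
rewrite -/(T p) -[T p]pT addrAC subrr add0r scalerN scalerA mulVf ?gt_eqF//.
by rewrite scale1r.
Qed.

(** Continuity in the anchor is what later makes the random solution [u k] strongly measurable. *)
Lemma regularized_solution_nonexpansive a c c' : 0 < a ->
  `|regularized_solution a c - regularized_solution a c'| <= `|c - c'|.
Proof.
move=> a0; apply: norm_le_of_dot_le0; rewrite dotC -(@pmulr_rle0 _ a)//.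
have := hA.1 _ _ _ _ (regularized_solution_graph c a0) (regularized_solution_graph c' a0).
set u := regularized_solution a c; set u' := regularized_solution a c'.
rewrite /regularized; have := hFmono u u'.
by rewrite !dotE; lra.
Qed.

Lemma regularized_solution_dist a c zstar : 0 < a -> add_op F A zstar 0 ->
  `|regularized_solution a c - c| <= `|c - zstar|.
Proof.
move=> a0 [v Av Fv]; rewrite -normrN; apply: norm_le_of_dot_le0.
rewrite -(@pmulr_rle0 _ a)//.
have := hA.1 _ _ _ _ (regularized_solution_graph c a0) Av.
set u := regularized_solution a c.
rewrite /regularized; have := hFmono u zstar.
have -> : v = - F zstar by apply/eqP; rewrite -addr_eq0 addrC; exact/eqP.
by rewrite !dotE; lra.
Qed.

Section Update.
Variables (a lambda : R) (c z : H).
Hypotheses (a0 : 0 < a) (l0 : 0 <= lambda).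
Let a' := a + lambda.
Let c' := a'^-1 *: (a *: c + lambda *: z).
Let u := regularized_solution a c.
Let u' := regularized_solution a' c'.

Let a'0 : 0 < a'. Proof. exact: ltr_wpDr. Qed.

(** Subtracting the two inclusions, the contributions of [F] and [A] are monotone and only the
    regularizing terms remain; by the choice of [c'] their difference [a' (u' - c') - a (u - c)] is
    the left factor here. The three estimates below all follow from this inequality. *)
Let update_mono : dot (a' *: (u' - z) - a *: (u - z)) (u' - u) <= 0.
Proof.
have := hA.1 _ _ _ _ (regularized_solution_graph c a0) (regularized_solution_graph c' a'0).
rewrite -/u -/u' /regularized.
have := hFmono u u'.
have -> : a' *: (u' - c') = a' *: u' - a *: c - lambda *: z.
  by rewrite scalerBr /c' scalerA mulfV ?gt_eqF// scale1r opprD addrA.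
by rewrite /a' !dotE; lra.
Qed.

Lemma update_solution_closer : `|u' - z| <= `|u - z|.
Proof.
(* For [lambda > 0] the inequality [update_mono] is divided by [lambda]; for [lambda = 0] the
   inclusion is unchanged and [u' = u]. *)
move: l0; rewrite le_eqVlt => /orP[/eqP lE|lp]; last first.
  apply: norm_le_of_dot_le0; rewrite -(@pmulr_rle0 _ lambda)//.
  have := update_mono; have := dot_ge0 hdot (u' - u).
  rewrite (_ : u' - z - (u - z) = u' - u); last by rewrite opprB addrA subrK.
  rewrite (_ : a' *: (u' - z) - a *: (u - z) = a *: (u' - u) + lambda *: (u' - z)); last first.
    by rewrite /a'; vector_ring hdot.
  rewrite [X in _ -> X <= 0 -> _](dotDl _ _ (_ *: _)) !dotZl => h.
  by have := mulr_ge0 (ltW a0) h; lra.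
suff -> : u' = u by [].
by rewrite /u' /u /c' /a' -lE addr0 scale0r addr0 scalerA mulVf ?gt_eqF// scale1r.
Qed.

Lemma update_anchor_dist : a' * `|u' - c'| <= a * `|u - c| + lambda * `|u - z|.
Proof.
(* This vector differs from [lambda *: (u - z)] by [a' *: (u' - u)], so [update_mono] gives the
   required angle. *)
have h : `|a' *: (u' - z) - a *: (u - z)| <= lambda * `|u - z|.
  rewrite -[X in X * `|u - z|]ger0_norm// -normrZ.
  apply: norm_le_of_dot_le0.
  rewrite (_ : _ - _ - _ = a' *: (u' - u)); last by rewrite /a'; vector_ring hdot.
  by rewrite dotZr pmulr_rle0.
rewrite -[X in X * `|u' - c'|]gtr0_norm// -[X in X * `|u - c|]gtr0_norm// -!normrZ.
apply: le_trans (lerD (lexx _) h); apply: le_trans (ler_normD _ _).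
rewrite scalerBr /c' scalerA mulfV ?gt_eqF// scale1r.
rewrite [leLHS](_ : _ = `|a *: (u - c) + (a' *: (u' - z) - a *: (u - z))|)//.
by congr `| _ |; rewrite /a'; vector_ring hdot.
Qed.

Lemma update_solution_dist : `|u' - u| <= lambda / a' * `|u - z|.
Proof.
rewrite mulrAC ler_pdivlMr// mulrC -[X in X * `|u' - u|]gtr0_norm//.
rewrite -[X in X * `|u - z|]ger0_norm// -!normrZ -[leRHS]normrN.
apply: norm_le_of_dot_le0; rewrite dotC.
have := update_mono.
rewrite (_ : a' *: (u' - z) - a *: (u - z) = a' *: (u' - u) - - (lambda *: (u - z))).
  by rewrite dotZr => h; rewrite pmulr_rle0.
by rewrite /a'; vector_ring hdot.
Qed.

End Update.
End Regularized.
End Operators.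
End Resolvent.

(** * The forward-backward-forward step and the residual *)

Section ForwardBackwardForward.
Context {R : realType} {H : completeNormedModType R} (dot : {dot H for idfun}).
Hypothesis hdot : induces_norm dot.
Variables (A : H -> set H) (hA : maximally_monotone dot A).

(** Here [e] is the noise of the first oracle call only; the noise of the second call is added in
    mean square by independence. Monotonicity of [A] between [y] and [u] controls the cross term of
    the expanded square. *)
Lemma fbf_step (B : H -> H) (a l eta : R) (z e u : H) :
  let y := resolvent A eta (z - eta *: (B z + e)) in
  0 <= a -> 0 < eta -> eta * l <= 3^-1 -> eta * a <= 6^-1 ->
  (forall x x', a * dot (x - x') (x - x') <= dot (B x - B x') (x - x')) ->
  (forall x x', `|B x - B x'| <= l * `|x - x'|) ->
  A u (- B u) ->
  `|y - eta *: (B y - B z - e) - u| ^+ 2 <=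
    (1 - 4 / 3 * (eta * a)) * `|z - u| ^+ 2 + 3 / 2 * eta ^+ 2 * `|e| ^+ 2.
Proof.
move=> y a0 eta0 etal etaa mB lB Au.
have Ay : A y (eta^-1 *: (z - eta *: (B z + e) - y)) := resolvent_graph hdot hA _ eta0.
have := hA.1 _ _ _ _ Ay Au; rewrite -(pmulr_rge0 _ eta0) -dotZl.
have -> : eta *: (eta^-1 *: (z - eta *: (B z + e) - y) - - B u) =
    (z - y) + eta *: (B y - B z - e) - eta *: (B y - B u).
  rewrite opprK scalerDr scalerA mulfV ?gt_eqF// scale1r; vector_ring hdot.
have lr : eta ^+ 2 * dot (B y - B z) (B y - B z) <= 9^-1 * dot (z - y) (z - y).
  rewrite -!hdot -exprMn (_ : 9^-1 = 3^-1 ^+ 2); last by field.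
  rewrite -exprMn ler_pXn2r ?nnegrE ?mulr_ge0 ?(ltW eta0)//.
  apply: le_trans (ler_wpM2l (ltW eta0) (lB _ _)) _.
  by rewrite mulrA (distrC y) ler_wpM2r.
have m := ler_wpM2l (ltW eta0) (mB y u).
have -> : y - eta *: (B y - B z - e) - u = (y - u) - eta *: (B y - B z - e).
  by vector_ring hdot.
have -> : z - u = (z - y) + (y - u) by vector_ring hdot.
move: (B y - B u) m => b; move: (B y - B z) lr => r; move: (z - y) (y - u) => s w.
rewrite !hdot => lr m mono.
(* The weights [3] and [3 / 2] in [h1] and [h2] exhaust the available [|s|^2]: [h1] with [lr] costs
   a third of it, [h2] with [eta a <= 1/6] costs the other two thirds. *)
have h1 : eta ^+ 2 * dot (r - e) (r - e) <=
    eta ^+ 2 * (3 * dot r r + 3 / 2 * dot e e).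
  apply: ler_wpM2l; first exact: sqr_ge0.
  have := dot_ge0 hdot (2 *: r + e).
  by rewrite !dotE (dotC dot e r); lra.
have h2 : eta * a * dot (s + w) (s + w) <= eta * a * (3 * dot s s + 3 / 2 * dot w w).
  apply: ler_wpM2l; first by rewrite mulr_ge0// ltW.
  have := dot_ge0 hdot (2 *: s - w).
  by rewrite !dotE (dotC dot w s); lra.
have h3 : eta * a * dot s s <= 6^-1 * dot s s by rewrite ler_wpM2r ?dot_ge0.
have E : dot (w - eta *: (r - e)) (w - eta *: (r - e)) =
   dot w w - 2 * (eta * dot (r - e) w) + eta ^+ 2 * dot (r - e) (r - e).
  by move: (r - e) => f; rewrite !dotE (dotC dot w f); ring.
rewrite E.
move: mono; rewrite [X in 0 <= X -> _]dotDl dotNl [X in 0 <= X - _ -> _]dotDl !dotZl => mono.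
have E2 : dot (s + w) (s + w) = dot s s + 2 * dot s w + dot w w.
  by rewrite !dotE (dotC dot w s); ring.
rewrite mulrBl mul1r {1}E2; move: h2; rewrite E2.
move: (dot (r - e) w) (dot (r - e) (r - e)) h1 mono => f g.
lra.
Qed.

Section Residual.
Variables (F : H -> H) (L : R).
Hypothesis hL : 0 < L.
Hypothesis hFmono : monotone_map dot F.
Hypothesis hFlip : forall x y, `|F x - F y| <= L * `|x - y|.

Let sqF x y : dot (F x - F y) (F x - F y) <= L ^+ 2 * dot (x - y) (x - y).
Proof. by rewrite -!hdot -exprMn ler_pXn2r ?nnegrE ?mulr_ge0// ltW. Qed.

Lemma forward_lipschitz x y :
  `|(x - L^-1 *: F x) - (y - L^-1 *: F y)| <= Num.sqrt 2 * `|x - y|.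
Proof.
apply: (norm_le_sqr hdot); first by rewrite mulr_ge0 ?sqrtr_ge0.
rewrite exprMn sqr_sqrtr// hdot.
have -> : (x - L^-1 *: F x) - (y - L^-1 *: F y) = (x - y) - L^-1 *: (F x - F y).
  by vector_ring hdot.
have := hFmono x y; have := sqF x y.
move: (F x - F y) (x - y) => f d h1 h2.
have h3 : L^-1 ^+ 2 * dot f f <= dot d d.
  by rewrite exprVn ler_pdivrMl ?exprn_gt0.
have h4 : 0 <= L^-1 * dot f d by rewrite mulr_ge0// invr_ge0 ltW.
by rewrite !dotE (dotC dot d f); lra.
Qed.

(** The vector [F z + L (q - z)] lies in [F z + A z]. It is compared through [p], the resolvent at
    the forward point [t] of [u]: firm nonexpansiveness handles the passage from [q] to [t], and
    [|p - u| <= |u - c|] handles the rest. *)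
Lemma forward_backward_residual u c q :
  A u (- regularized F L c u) ->
  (residual F A (resolvent A L^-1 q) <=
   (Num.sqrt 2 * L * (`|q - (u - L^-1 *: F u)| + `|u - c|))%:E)%E.
Proof.
move=> Au; set z := resolvent A L^-1 q.
have Li0 : 0 < L^-1 by rewrite invr_gt0.
apply: (@le_trans _ _ (`|F z + L *: (q - z)|)%:E).
  apply: ereal_inf_lbound; exists (F z + L *: (q - z)) => //.
  exists (L *: (q - z)) => //.
  by have := resolvent_graph hdot hA q Li0; rewrite invrK.
rewrite lee_fin.
set t := u - L^-1 *: F u.
pose p := resolvent A L^-1 t.
have pu : `|p - u| <= `|u - c|.
  (* Because the regularization weight equals [L], the inclusion solved by [u] is itself a
     forward-backward equation with step [1 / L], based at [c] instead of [u]. *)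
  have uJ : u = resolvent A L^-1 (c - L^-1 *: F u).
    have Ay := resolvent_graph hdot hA (c - L^-1 *: F u) Li0.
    set y := resolvent _ _ _ in Ay *.
    have := hA.1 _ _ _ _ Ay Au; rewrite invrK /regularized.
    have -> : L *: (c - L^-1 *: F u - y) - - (F u + L *: (u - c)) = - (L *: (y - u)).
      apply: (dot_ext hdot) => w; rewrite !dotE; field; exact: lt0r_neq0.
    rewrite dotNl dotZl oppr_ge0 pmulr_rle0// => h.
    apply/eqP; rewrite eq_sym -subr_eq0 -normr_eq0 -sqrf_eq0 hdot eq_le h.
    by rewrite (dot_ge0 hdot).
  rewrite {1}uJ; apply: le_trans (resolvent_nonexpansive hdot hA _ _ Li0) _.
  by rewrite /t (_ : _ - _ = u - c)//; vector_ring hdot.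
have -> : F z + L *: (q - z) =
   (F z - F p + L *: ((q - t) - (z - p))) + L *: ((u - L^-1 *: F u) - (p - L^-1 *: F p)).
  rewrite /t; apply: (dot_ext hdot) => w; rewrite !dotE; field; exact: lt0r_neq0.
apply: le_trans (ler_normD _ _) _.
rewrite mulrDr lerD//; last first.
  rewrite normrZ gtr0_norm// -mulrA mulrCA ler_pM2l//.
  apply: le_trans (forward_lipschitz _ _) _.
  by rewrite distrC ler_wpM2l ?sqrtr_ge0.
apply: (norm_le_sqr hdot); first by rewrite !mulr_ge0 ?sqrtr_ge0 ?(ltW hL).
have := resolvent_firm hdot hA q t Li0; rewrite -/z -/p => firm.
rewrite -mulrA exprMn sqr_sqrtr// exprMn hdot.
have := sqF z p; move: (F z - F p) firm; move: (q - t) (z - p) => h d f firm hf.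
(* This gives [|f + L (h - d)|^2 <= 2 |f|^2 + 2 L^2 |h - d|^2]; with [|f| <= L |d|] and firmness,
   [|d|^2 <= <h, d>], the right side is at most [2 L^2 |h|^2]. *)
have h1 := dot_ge0 hdot (f - L *: (h - d)).
have h2 := ler_wpM2l (sqr_ge0 L) firm.
have h3 : 0 <= L ^+ 2 * dot d d by rewrite mulr_ge0 ?sqr_ge0 ?(dot_ge0 hdot).
rewrite mulr0 in h2.
move: h1 h2; rewrite !dotE !(dotC dot d h) (dotC dot h f) (dotC dot d f).
by lra.
Qed.

End Residual.
End ForwardBackwardForward.

(** * Random vectors *)

Section StrongMeasurability.
Context {d : measure_display} {T : measurableType d} {R : realType}.
Implicit Types H : normedModType R.

Lemma vsimple_preimage H (s : T -> H) (B : set H) :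
  vsimple s -> measurable (s @^-1` B).
Proof.
move=> [fs ms]; rewrite (_ : _ @^-1` _ = \bigcup_(v in range s `&` B) s @^-1` [set v]).
  by apply: fin_bigcup_measurable => //; exact: finite_setIl.
apply/seteqP; split => t /=; first by move=> Bst; exists (s t).
by move=> [v [_ Bv] /= ->].
Qed.

Lemma vsimple_cst H (v : H) : vsimple (cst v : T -> H).
Proof.
split; first by apply: (sub_finite_set _ (finite_set1 v)) => _ [t _ <-].
by move=> w; rewrite preimage_cst; case: ifP => _; [exact: measurableT|exact: measurable0].
Qed.

Lemma vsimple_comp H1 H2 (f : H1 -> H2) (s : T -> H1) :
  vsimple s -> vsimple (f \o s).
Proof.
move=> vs; split.
  by rewrite -(image_comp s f); apply: finite_image; exact: vs.1.
by move=> v; rewrite comp_preimage; exact: vsimple_preimage.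
Qed.

Lemma vsimple_comp2 H1 H2 H3 (f : H1 -> H2 -> H3) (s : T -> H1) (r : T -> H2) :
  vsimple s -> vsimple r -> vsimple (fun t => f (s t) (r t)).
Proof.
move=> vs vr; split.
  apply: (sub_finite_set _ (finite_image2 f vs.1 vr.1)) => _ [t _ <-].
  by exists (s t); [exists t|exists (r t); [exists t|]].
move=> v; rewrite (_ : _ @^-1` _ =
    \bigcup_(x in range s) (s @^-1` [set x] `&` (r @^-1` (f x @^-1` [set v])))).
  apply: fin_bigcup_measurable => [|x _]; first exact: vs.1.
  by apply: measurableI; exact: vsimple_preimage.
apply/seteqP; split => t /=; first by move=> <-; exists (s t).
by move=> [x _ /= [->]].
Qed.

Lemma strongly_measurable_cst H (v : H) : strongly_measurable (cst v : T -> H).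
Proof.
by exists (fun=> cst v); split=> [n|t]; [exact: vsimple_cst|exact: cvg_cst].
Qed.

Lemma strongly_measurable_comp H1 H2 (f : H1 -> H2) (X : T -> H1) :
  continuous f -> strongly_measurable X -> strongly_measurable (f \o X).
Proof.
move=> cf [s [vs sX]]; exists (fun n => f \o s n); split=> [n|t].
  exact: vsimple_comp.
by apply: (cvg_comp _ _ (sX t)); exact: cf.
Qed.

Lemma strongly_measurableD H (X Y : T -> H) :
  strongly_measurable X -> strongly_measurable Y ->
  strongly_measurable (fun t => X t + Y t).
Proof.
move=> [s [vs sX]] [r [vr rY]]; exists (fun n t => s n t + r n t); split=> [n|t].
  exact: (vsimple_comp2 +%R).
by apply: cvgD; [exact: sX|exact: rY].
Qed.

Lemma strongly_measurableZ H a (X : T -> H) :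
  strongly_measurable X -> strongly_measurable (fun t => a *: X t).
Proof. by apply: strongly_measurable_comp => x; exact: scaler_continuous. Qed.

Lemma strongly_measurableN H (X : T -> H) :
  strongly_measurable X -> strongly_measurable (fun t => - X t).
Proof. by apply: strongly_measurable_comp => x; exact: opp_continuous. Qed.

Lemma strongly_measurableB H (X Y : T -> H) :
  strongly_measurable X -> strongly_measurable Y ->
  strongly_measurable (fun t => X t - Y t).
Proof.
by move=> mX mY; apply: strongly_measurableD => //; exact: strongly_measurableN.
Qed.

Lemma strongly_measurable_real (f : T -> R) :
  strongly_measurable f -> measurable_fun setT f.
Proof.
move=> [s [vs sf]]; apply: (@measurable_realfun.measurable_fun_cvg _ T R setT s f) => [n|t _];
  last exact: sf.
by move=> _ B _; rewrite setTI; exact: vsimple_preimage.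
Qed.

Lemma strongly_measurable_norm H (X : T -> H) :
  strongly_measurable X -> measurable_fun setT (fun t => `|X t|).
Proof.
move=> mX; apply: strongly_measurable_real.
by apply: (strongly_measurable_comp _ mX) => x; exact: norm_continuous.
Qed.

End StrongMeasurability.

Lemma strongly_measurable_precomp {d d' : measure_display} {T : measurableType d}
    {T' : measurableType d'} {R : realType} {H : normedModType R}
    (phi : T' -> T) (X : T -> H) :
  measurable_fun setT phi -> strongly_measurable X -> strongly_measurable (X \o phi).
Proof.
move=> mphi [s [vs sX]]; exists (fun n => s n \o phi); split=> [n|t]; last exact: sX.
split; first by apply: (sub_finite_set _ (vs n).1) => _ [t _ <-]; exists (phi t).
move=> v; rewrite comp_preimage -[X in measurable X]setTI.
by apply: mphi => //; exact: (vs n).2.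
Qed.

Lemma lipschitz1_continuous {R : realType} {V W : normedModType R} (k : R) (f : V -> W) :
  (forall x y, `|f x - f y| <= k * `|x - y|) -> continuous f.
Proof.
move=> fk x; apply/cvgrPdist_le => e e0.
have k0 : 0 < `|k| + 1 by rewrite ltr_pwDr.
have r0 : 0 < e / (`|k| + 1) by rewrite divr_gt0.
apply: filterS (nbhsx_ballx x _ r0) => y.
rewrite -ball_normE /ball_ /= ltr_pdivlMr// mulrC => /ltW xy.
apply: le_trans (fk _ _) (le_trans _ xy).
by rewrite ler_wpM2r// (le_trans (ler_norm _))// lerDl.
Qed.

(** * First and second moments of centered random vectors *)

Section Moments.
Context {d : measure_display} {T : measurableType d} {R : realType}
  {H : normedModType R} (dot : {dot H for idfun}).
Hypothesis hdot : induces_norm dot.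
Variable mu : probability T R.
Local Open Scope ereal_scope.

Lemma dot_continuousl w : continuous (dot ^~ w).
Proof.
apply: (@lipschitz1_continuous _ _ _ `|w|%R) => x y.
by rewrite -dotNl -dotDl mulrC (CauchySchwarz_dot hdot).
Qed.

Lemma measurable_dotl (X : T -> H) w :
  strongly_measurable X -> measurable_fun setT (fun t => dot (X t) w).
Proof.
move=> mX; apply: strongly_measurable_real.
exact: strongly_measurable_comp (@dot_continuousl w) mX.
Qed.

Section Simple.
Variables (s : T -> H) (w : H).
Hypothesis vs : vsimple s.

Let r := fset_set (range s).

Let sE : (fun t => (dot (s t) w)%:E) =
  (fun t => \sum_(v <- r) (dot v w)%:E * (\1_(s @^-1` [set v]) t)%:E).
Proof.
apply/funext => t; have rs : s t \in r by rewrite in_fset_set ?inE; [exists t|exact: vs.1].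
rewrite (bigD1_seq (s t)) ?fset_uniq//= big1_seq ?adde0.
  by rewrite indicE mem_set// mule1.
move=> v /andP[vs' _]; rewrite indicE memNset ?mule0// => /= stv.
by rewrite stv eqxx in vs'.
Qed.

Let integrable_term v :
  mu.-integrable setT (fun t => (dot v w)%:E * (\1_(s @^-1` [set v]) t)%:E).
Proof.
by apply: integrableZl => //; apply: integrable_indic; case: vs => _; exact.
Qed.

Lemma integrable_dot_vsimple : mu.-integrable setT (fun t => (dot (s t) w)%:E).
Proof. by rewrite sE; apply: integrable_sum => // v _; exact: integrable_term. Qed.

Lemma integral_dot_vsimple :
  \int[mu]_t (dot (s t) w)%:E = (dot (vsimple_expectation mu s) w)%:E.
Proof.
rewrite sE integral_sum//.
rewrite /vsimple_expectation fsbig_finite/=; last exact: vs.1.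
rewrite (big_morph (dot ^~ w) (fun x y => dotDl dot x y w) (dot0l dot w)).
rewrite -sumEFin; apply: eq_bigr => v _.
have mv : measurable (s @^-1` [set v]) by case: vs.
rewrite (integralZl measurableT (integrable_indic _ mv)) integral_indic// setIT.
by rewrite dotZl EFinM muleC fineK// fin_num_measure.
Qed.

End Simple.

Lemma integrable_dotl (X : T -> H) w : strongly_measurable X ->
  mu.-integrable setT (fun t => `|X t|%:E) ->
  mu.-integrable setT (fun t => (dot (X t) w)%:E).
Proof.
move=> mX iX; apply: (@le_integrable _ _ _ mu setT _ _ (fun t => `|w|%:E * `|X t|%:E)) => //.
- exact/measurable_EFinP/measurable_dotl.
- move=> t _; rewrite -EFinM !abse_EFin lee_fin mulrC.
  by rewrite (le_trans (CauchySchwarz_dot hdot _ _))// ler_norm.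
- exact: integrableZl.
Qed.

Lemma integral_dot_mean0 (Y : T -> H) w : has_expectation mu Y 0%R ->
  mu.-integrable setT (fun t => `|Y t|%:E) -> \int[mu]_t (dot (Y t) w)%:E = 0.
Proof.
move=> [mY [s [vs Ys Es]]] iY; have iYw := integrable_dotl w mY iY.
(* Pairing with [w] commutes with the expectation of a simple function, so the error splits into the
   approximation error of [s n] and its expectation; both tend to zero. *)
have bound n : `|\int[mu]_t (dot (Y t) w)%:E| <=
   `|w|%:E * (\int[mu]_t `|Y t - s n t|%:E) + (`|w| * `|vsimple_expectation mu (s n)|)%:E.
  have mYs : strongly_measurable (fun t => Y t - s n t)%R.
    apply: strongly_measurableB => //; exists (fun=> s n).
    by split=> // t; exact: cvg_cst.
  have isn := integrable_dot_vsimple w (vs n).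
  have iYs : mu.-integrable setT (fun t => (dot (Y t - s n t)%R w)%:E).
    rewrite (_ : (fun t => _) = (fun t => (dot (Y t) w)%:E - (dot (s n t) w)%:E)).
      exact: integrableB.
    by apply/funext => t; rewrite dotDl dotNl.
  have -> : \int[mu]_t (dot (Y t) w)%:E =
      \int[mu]_t (dot (Y t - s n t)%R w)%:E + \int[mu]_t (dot (s n t) w)%:E.
    rewrite -integralD//; apply: eq_integral => t _.
    by rewrite -EFinD -dotDl subrK.
  rewrite (integral_dot_vsimple w (vs n)); apply: le_trans (lee_abs_add _ _) _.
  apply: leeD; last by rewrite abse_EFin lee_fin mulrC (CauchySchwarz_dot hdot).
  have mYw : measurable_fun setT (fun t => (dot (Y t - s n t)%R w)%:E).
    exact/measurable_EFinP/measurable_dotl.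
  apply: le_trans (le_abse_integral mu measurableT mYw) _.
  rewrite -ge0_integralZl//; last first.
    exact/measurable_EFinP/strongly_measurable_norm.
  apply: ge0_le_integral => //.
  - exact/measurableT_comp.
  - apply: measurable_funeM; exact/measurable_EFinP/strongly_measurable_norm.
  - by move=> t _; rewrite abse_EFin -EFinM lee_fin mulrC (CauchySchwarz_dot hdot).
have lim0 : (fun n => `|w|%:E * (\int[mu]_t `|Y t - s n t|%:E) +
    (`|w| * `|vsimple_expectation mu (s n)|)%:E) @ \oo --> 0.
  rewrite -[X in _ --> X]adde0; apply: cvgeD => //.
    by rewrite -(mule0 `|w|%:E); apply: cvgeZl.
  apply: cvg_EFin; first exact: nearW.
  rewrite -(mulr0 `|w|%R) -(@normr0 _ H); apply: cvgMl_tmp; exact: cvg_norm.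
have : `|\int[mu]_t (dot (Y t) w)%:E| <= 0.
  rewrite -(cvg_lim _ lim0)//; apply: lime_ge; first by apply/cvg_ex; exists 0.
  exact: nearW.
by move=> le0; apply/eqP; rewrite -abse_eq0 eq_le le0 abse_ge0.
Qed.

(** Expanding the square, the cross term vanishes by [integral_dot_mean0]. Integrability of the norm
    comes from [|Y| <= 1 + |Y|^2]. *)
Lemma integral_norm_sqr_shift (Y : T -> H) w (c v : R) : has_expectation mu Y 0%R ->
  \int[mu]_t (`|Y t| ^+ 2)%:E <= v%:E ->
  \int[mu]_t (`|w + c *: Y t| ^+ 2)%:E <= (`|w| ^+ 2 + c ^+ 2 * v)%:E.
Proof.
move=> EY vY; have [mY _] := EY.
have mY2 : measurable_fun setT (fun t => (`|Y t| ^+ 2)%:E : \bar R).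
  apply/measurable_EFinP/measurable_funX; exact: strongly_measurable_norm.
have iY2 : mu.-integrable setT (fun t => (`|Y t| ^+ 2)%:E).
  apply/integrableP; split => //.
  apply: le_lt_trans (ltry v); apply: le_trans vY.
  by under eq_integral do rewrite abse_EFin ger0_norm ?sqr_ge0//.
have ic k : mu.-integrable setT (fun _ => k%:E : \bar R).
  exact: finite_measure_integrable_cst.
have iY : mu.-integrable setT (fun t => `|Y t|%:E).
  apply: (@le_integrable _ _ _ mu setT _ _ (fun t => 1%:E + (`|Y t| ^+ 2)%:E)) => //.
  - exact/measurable_EFinP/strongly_measurable_norm.
  - move=> t _; rewrite -EFinD !abse_EFin lee_fin normr_id ger0_norm ?addr_ge0//.
    by have := sqr_ge0 (`|Y t| - 1)%R; have := normr_ge0 (Y t); nra.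
  - by apply: integrableD => //; exact: ic.
have iYw := integrable_dotl w mY iY.
have -> : \int[mu]_t (`|w + c *: Y t| ^+ 2)%:E =
   \int[mu]_t (((`|w| ^+ 2)%:E + (2 * c)%:E * (dot (Y t) w)%:E) + (c ^+ 2)%:E * (`|Y t| ^+ 2)%:E).
  apply: eq_integral => t _; rewrite -!EFinM -!EFinD !hdot; congr (_%:E).
  by rewrite !dotE (dotC dot w); ring.
rewrite integralD//; last 2 first.
- by apply: integrableD => //; exact: integrableZl.
- exact: integrableZl.
rewrite integralD//; last exact: integrableZl.
rewrite !integralZl// integral_dot_mean0// mule0 adde0 integral_cst//.
rewrite [X in _ * X + _](_ : _ = 1); last exact: probability_setT.
rewrite mule1 EFinD leeD2l// (EFinM (c ^+ 2)%R v).
by apply: lee_wpmul2l => //; rewrite lee_fin sqr_ge0.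
Qed.

End Moments.

(** * Freezing a variable independent of the integrating sample *)

Section Freezing.
Context {dO dX dT : measure_display} {Omega : measurableType dO} {X : measurableType dX}
  {T : measurableType dT} {R : realType} (P : probability Omega R) (mu : probability X R)
  (xi : {RV P >-> X}) (pi : Omega -> T).
Hypothesis mpi : measurable_fun setT pi.
Hypothesis indep : forall B A, measurable B -> measurable A ->
  (P (xi @^-1` B `&` pi @^-1` A) = mu B * P (pi @^-1` A))%E.
Local Open Scope ereal_scope.

Let pi_mixin := isMeasurableFun.Build _ _ _ _ _ mpi.
Let pi_rv : {mfun Omega >-> T} := HB.pack pi pi_mixin.

(** Independence on rectangles identifies the joint law of [(xi, pi)] with a product measure, and
    Tonelli integrates out [xi] first. The target [T] is later [Omega] itself under a coarser
    sigma-algebra, with [pi] the identity. *)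
Lemma ge0_integral_freeze (f : X * T -> \bar R) :
  measurable_fun setT f -> (forall p, 0 <= f p) ->
  \int[P]_w f (xi w, pi w) = \int[P]_w \int[mu]_x f (x, pi w).
Proof.
move=> mf f0.
pose phi w := (xi w, pi w).
have mphi : measurable_fun setT phi by apply: measurable_fun_pair.
pose phi_mixin := isMeasurableFun.Build _ _ _ _ _ mphi.
pose phi_rv : {mfun Omega >-> (X * T)%type} := HB.pack phi phi_mixin.
pose nu := distribution P pi_rv.
have E : forall C, measurable C -> (mu \x nu) C = distribution P phi_rv C.
  apply: product_measure_unique => B A mB mA.
  exact: indep.
transitivity (\int[distribution P phi_rv]_p f p).
  by rewrite ge0_integral_pushforward.
transitivity (\int[mu \x nu]_p f p).
  by apply: eq_measure_integral => C mC _; exact/esym/E.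
rewrite fubini_tonelli2// ge0_integral_pushforward//.
  exact: measurable_fun_fubini_tonelli_G.
by move=> t _; exact: integral_ge0.
Qed.

End Freezing.

(** * Sigma-algebras generated by families of samples *)

Section History.
Context {dO dX : measure_display} {Omega : measurableType dO} {T : measurableType dX}
  {R : realType} (P : probability Omega R) {I : choiceType} (X : I -> {RV P >-> T}).

Definition cylinders (J : set I) : set (set Omega) :=
  [set A | exists (K : {fset I}) (B : I -> set T),
     [/\ forall i, measurable (B i), [set` K] `<=` J &
         A = \bigcap_(i in [set` K]) X i @^-1` B i]].

(** The points are those of [Omega] and only the sigma-algebra shrinks, so measurability with
    respect to the samples in [J] is plain measurability on this type. *)
Definition history (J : set I) := g_sigma_algebraType (cylinders J).

Lemma cylinders_measurable J : cylinders J `<=` measurable.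
Proof.
move=> _ [K [B [mB _ ->]]]; apply: fin_bigcap_measurable => // i _.
by rewrite -[X in measurable X]setTI; exact: measurable_funPT.
Qed.

Lemma cylinders_setI J : setI_closed (cylinders J).
Proof.
move=> _ _ [K [B [mB KJ ->]]] [K' [B' [mB' KJ' ->]]].
exists (K `|` K')%fset.
exists (fun i => (if i \in K then B i else setT) `&` (if i \in K' then B' i else setT)).
split.
- by move=> i; apply: measurableI; case: ifP.
- by move=> i /=; rewrite in_fsetU => /orP[/KJ|/KJ'].
- apply/seteqP; split => w.
    by move=> [h h'] i _; split; case: ifPn => // iK; [exact: h|exact: h'].
  move=> h; split => i /= iK.
    by have := h i; rewrite /= in_fsetU iK => /(_ isT)[].
  by have := h i; rewrite /= in_fsetU iK orbT => /(_ isT)[].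
Qed.

Lemma cylinders_setT J : cylinders J setT.
Proof.
exists fset0, (fun=> setT); split=> [i|i|] //=.
by apply/esym/seteqP; split=> // w _ i.
Qed.

Lemma measurable_to_history J : measurable_fun setT (id : Omega -> history J).
Proof.
move=> _ A mA; rewrite setTI preimage_id.
exact: (smallest_sub (@sigma_algebra_measurable _ Omega) (@cylinders_measurable J)).
Qed.

Lemma measurable_history_sub J J' : J `<=` J' ->
  measurable_fun setT (id : history J' -> history J).
Proof.
move=> JJ' _ A mA; rewrite setTI preimage_id.
apply: sub_sigma_algebra2 mA => _ [K [B [mB KJ ->]]]; exists K, B; split => //.
exact: subset_trans KJ JJ'.
Qed.

Lemma measurable_history J i : J i -> measurable_fun setT (X i : history J -> T).
Proof.
move=> Ji _ B mB; rewrite setTI; apply: sub_sigma_algebra.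
exists [fset i]%fset, (fun=> B); split => //.
  by move=> j /=; rewrite in_fset1 => /eqP ->.
apply/seteqP; split => w /=; first by move=> Bw j /=; rewrite in_fset1 => /eqP ->.
by apply; rewrite /= in_fset1.
Qed.

(** Both sides are finite measures in [A] that agree on the cylinders, a generating family closed
    under intersection. *)
Lemma history_independent J i B (A : set (history J)) :
  mutually_independent X -> ~ J i -> measurable B -> measurable A ->
  P (X i @^-1` B `&` A) = (P (X i @^-1` B) * P A)%E.
Proof.
move=> indep nJi mB mA.
have mXB : measurable (X i @^-1` B).
  by rewrite -[X in measurable X]setTI; exact: measurable_funPT.
have p0 : 0 <= fine (P (X i @^-1` B)) by exact: fine_ge0.
have -> : P (X i @^-1` B) = (fine (P (X i @^-1` B)))%:E by rewrite fineK// fin_num_measure.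
rewrite setIC.
apply: (g_sigma_algebra_measure_unique (cylinders J) _ (fun=> setT) _ _
  (mrestr P mXB) (mscale (NngNum p0) P)) mA => //.
- exact: cylinders_measurable.
- by move=> _; exact: cylinders_setT.
- by rewrite bigcup_const.
- exact: cylinders_setI.
- move=> _ [K [C [mC KJ ->]]].
  have iK : i \notin K by apply/negP => /KJ.
  rewrite /mrestr /mscale.
  rewrite [X in _ = (X * _)%E](_ : _ = P (X i @^-1` B)); last first.
    by rewrite -[RHS]fineK// fin_num_measure.
  (* Prescribing [B] at the extra index [i] lets mutual independence split off the factor of [X i];
     as [i] is not in [K], the other factors are unchanged. *)
  pose C' j := if j == i then B else C j.
  have mC' j : measurable (C' j) by rewrite /C'; case: ifP.
  have C'i : C' i = B by rewrite /C' eqxx.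
  have := indep (i |` K)%fset C' mC'.
  rewrite big_fsetU1//= C'i.
  have -> : \bigcap_(j in [set` (i |` K)%fset]) X j @^-1` C' j =
      (\bigcap_(j in [set` K]) X j @^-1` C j) `&` X i @^-1` B.
    apply/seteqP; split => w /=.
      move=> h; split; last by have := h i; rewrite /C' eqxx; apply; rewrite /= in_fset1U eqxx.
      move=> j /= jK; have := h j; rewrite /C' ifN; first by apply; rewrite /= in_fset1U jK orbT.
      by apply: contraNneq iK => <-.
    move=> [h hi] j /=; rewrite in_fset1U /C'; case: eqP => [->//|_ /= jK]; exact: h.
  move=> h; apply: (etrans h); congr (_ * _)%E.
  apply/esym/(etrans (indep K C mC)); apply: eq_big_seq => j jK.
  rewrite /C' ifN//; by apply: contraNneq iK => <-.
- move=> _; apply: (@le_lt_trans _ _ (P (setT `&` X i @^-1` B))) => //.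
  by rewrite setTI (le_lt_trans (probability_le1 P _))// ltry.
Qed.

End History.

(** * Regularization weights *)

Section Weights.
Context {R : realType}.
Variables (L : R) (N : nat) (a0 gamma Q : R) (a eta : nat -> R).
Hypotheses (hL : 0 < L) (ha0 : 0 < a0 < L) (hgamma : 0 < gamma <= 3^-1)
  (hQ1 : 1 <= Q) (ha_0 : a 0%N = a0)
  (heta : forall k, eta k = (3 * (L + Q * a k))^-1)
  (ha_S : forall k, a k.+1 = Num.min L (a k / (1 - gamma * eta k * a k))).

Let Q1 : 0 < Q + 1. Proof. by rewrite ltr_wpDl// (le_trans ler01). Qed.

Let step_bounds k : 0 < a k <= L ->
  [/\ 0 < eta k, eta k * a k <= (3 * (Q + 1))^-1 & eta k * (L + a k) <= 3^-1].
Proof.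
move=> /andP[ak akL].
have Qa : a k <= Q * a k by rewrite ler_peMl// ltW.
have d0 : 0 < 3 * (L + Q * a k) by lra.
have Q0 : 0 < 3 * (Q + 1) by rewrite mulr_gt0.
split; rewrite heta ?invr_gt0//; last by rewrite ler_pdivrMl//; lra.
by rewrite ler_pdivrMl// ler_pdivlMr//; lra.
Qed.

Let rho_bounds k : 0 < a k <= L ->
  [/\ 0 < gamma * eta k * a k, gamma * eta k * a k <= (9 * (Q + 1))^-1 &
      gamma * eta k * a k < 1].
Proof.
move=> ak; have [e0 ea _] := step_bounds ak.
case/andP: ak => ak _; case/andP: hgamma => g0 g3.
have h1 : 0 < gamma * eta k * a k by rewrite !mulr_gt0.
have h2 : gamma * eta k * a k <= (9 * (Q + 1))^-1.
  rewrite -mulrA (_ : 9 * (Q + 1) = 3 * (3 * (Q + 1))); last by ring.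
  by rewrite [X in _ <= X]invfM; apply: ler_pM => //; [exact: ltW|exact/mulr_ge0/ltW/ak/ltW].
split => //; apply: le_lt_trans h2 _.
by rewrite invf_lt1; have := hQ1; lra.
Qed.

Lemma weight_bounds k : 0 < a k <= L.
Proof.
elim: k => [|k ih]; first by rewrite ha_0; case/andP: ha0 => -> /ltW ->.
have [_ _ r1] := rho_bounds ih.
rewrite ha_S lt_min hL ge_min lexx andbT /= divr_gt0 ?subr_gt0//.
by case/andP: ih.
Qed.

Lemma weight_gt0 k : 0 < a k. Proof. by case/andP: (weight_bounds k). Qed.
Lemma weight_le k : a k <= L. Proof. by case/andP: (weight_bounds k). Qed.

Lemma step_gt0 k : 0 < eta k.
Proof. by have [] := step_bounds (weight_bounds k). Qed.

Lemma step_weight_le k : eta k * a k <= (3 * (Q + 1))^-1.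
Proof. by have [] := step_bounds (weight_bounds k). Qed.

Lemma step_weight_le6 k : eta k * a k <= 6^-1.
Proof.
by apply: le_trans (step_weight_le k) _; rewrite lef_pV2 ?posrE//; have := hQ1; lra.
Qed.

Lemma step_lipschitz_le k : eta k * (L + a k) <= 3^-1.
Proof. by have [] := step_bounds (weight_bounds k). Qed.

Lemma ratio_ge k : 1 - gamma * eta k * a k <= a k / a k.+1.
Proof.
have [_ _ r1] := rho_bounds (weight_bounds k).
rewrite ler_pdivlMr ?weight_gt0// mulrC -ler_pdivlMr ?subr_gt0//.
by rewrite ha_S ge_min lexx orbT.
Qed.

Lemma ratio_ge9 k : 1 - (9 * (Q + 1))^-1 <= a k / a k.+1.
Proof.
have [_ r1 _] := rho_bounds (weight_bounds k).
by apply: le_trans (ratio_ge k); rewrite lerD2l lerN2.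
Qed.

Lemma weight_nondecreasing k : a k <= a k.+1.
Proof.
have [r0 _ r1] := rho_bounds (weight_bounds k).
rewrite ha_S le_min weight_le /= ler_pdivlMr ?subr_gt0//.
by have := weight_gt0 k; nra.
Qed.

Lemma weight_homo : {homo a : i j / (i <= j)%N >-> i <= j}.
Proof. by move/nondecreasing_seqP : weight_nondecreasing. Qed.

Lemma ratio_le1 k : a k / a k.+1 <= 1.
Proof. by rewrite ler_pdivrMr ?weight_gt0// mul1r weight_nondecreasing. Qed.

Lemma one_sub_ratio_le_ln k : 1 - a k / a k.+1 <= ln (a k.+1) - ln (a k).
Proof.
have r0 : 0 < a k / a k.+1 by rewrite divr_gt0 ?weight_gt0.
have := @le_ln1Dx R (a k / a k.+1 - 1); rewrite addrCA subrr addr0.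
rewrite ln_div ?posrE ?weight_gt0// => h.
by have : -1 < a k / a k.+1 - 1; [lra|move=> /h; lra].
Qed.

Lemma sum_one_sub_ratio_le_ln n :
  \sum_(0 <= k < n) (1 - a k / a k.+1) <= ln (a n) - ln a0.
Proof.
rewrite -ha_0 -(telescope_sumr (fun k => ln (a k)))//.
by apply: ler_sum => k _; exact: one_sub_ratio_le_ln.
Qed.

(** If [a N < L], the minimum never truncates and each step contributes exactly [gamma / 3] to a sum
    that telescopes up to a logarithm. [Q] is chosen so that [N] such contributions bring the weight
    all the way to [L], a contradiction. *)
Lemma weight_max : Q = Qparam L gamma N a0 -> a N = L.
Proof.
move=> hQ.
apply/eqP; rewrite eq_le weight_le leNgt; apply/negP => aNL.
have aL k : (k <= N)%N -> a k < L.
  by move=> kN; apply: le_lt_trans aNL; exact: weight_homo.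
(* Without truncation [1 - a k / a k.+1 = gamma * eta k * a k], and
   [eta k * (L + Q * a k) = 1 / 3]. *)
have stepE k : (k < N)%N -> gamma / 3 = L * ((a k)^-1 - (a k.+1)^-1) + Q * (1 - a k / a k.+1).
  move=> kN.
  have [r0 _ r1] := rho_bounds (weight_bounds k).
  have := aL _ kN; rewrite ha_S; case: (leP L (a k / _)) => [_|_ _]; first by rewrite ltxx.
  have ak := weight_gt0 k.
  have d0 : 0 < L + Q * a k by rewrite addr_gt0// mulr_gt0//; have := hQ1; lra.
  have x0 : 1 - gamma * eta k * a k != 0 by rewrite gt_eqF// subr_gt0.
  rewrite invf_div mulrCA mulfV ?gt_eqF// mulr1.
  transitivity (gamma * eta k * (L + Q * a k)).
    by rewrite heta; field; rewrite gt_eqF.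
  by field; rewrite gt_eqF.
have lnL : 0 < ln (L / a0) by rewrite ln_gt0// ltr_pdivlMr ?mul1r; case/andP: ha0.
have QE : gamma * N%:R / 3 = (L / a0 - 1) + Q * ln (L / a0).
  by rewrite hQ /Qparam divfK ?gt_eqF// addrC subrK.
have : gamma * N%:R / 3 <= L * (a0^-1 - (a N)^-1) + Q * (ln (a N) - ln a0).
  have -> : gamma * N%:R / 3 = \sum_(0 <= k < N) gamma / 3.
    by rewrite sumr_const_nat subn0 -mulr_natr; ring.
  rewrite big_nat (eq_bigr _ (fun k kN => stepE k (andP kN).2)) -big_nat.
  rewrite big_split/= -!mulr_sumr lerD//.
    rewrite le_eqVlt -ha_0; apply/orP; left; apply/eqP; congr (_ * _).
    rewrite -[RHS]opprB -(telescope_sumr (fun k => (a k)^-1))// -sumrN.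
    by apply: eq_bigr => k _; rewrite opprB.
  by rewrite ler_wpM2l ?sum_one_sub_ratio_le_ln//; have := hQ1; lra.
have a00 : 0 < a0 by case/andP: ha0.
rewrite QE ln_div ?posrE//.
have : ln (a N) < ln L by rewrite ltr_ln ?posrE ?weight_gt0.
have : L^-1 < (a N)^-1 by rewrite ltf_pV2 ?posrE ?weight_gt0.
have : L * L^-1 = 1 by rewrite mulfV// gt_eqF.
move: (ln (a N)) (ln L) (L^-1) ((a N)^-1) => x y Li v LLi Lv xy.
have : Q * x < Q * y by rewrite ltr_pM2l//; have := hQ1; lra.
have : L * Li < L * v by rewrite ltr_pM2l.
lra.
Qed.

Lemma tail_sum_le i n : (i <= n)%N -> (n - i)%:R <= Q ->
  \sum_(i <= k < n) (1 - a k / a k.+1) <= 9^-1.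
Proof.
move=> le_in niQ; have Q9 : 0 < 9 * (Q + 1) by rewrite mulr_gt0.
apply: (@le_trans _ _ (\sum_(i <= k < n) (9 * (Q + 1))^-1)).
  by apply: ler_sum => k _; rewrite lerBlDr -lerBlDl ratio_ge9.
rewrite sumr_const_nat -[leLHS]mulr_natl ler_pdivrMr//.
by move: niQ; have := hQ1; lra.
Qed.

Lemma tail_sum_ge0 i n : 0 <= \sum_(i <= k < n) (1 - a k / a k.+1).
Proof. by apply: sumr_ge0 => k _; rewrite subr_ge0 ratio_le1. Qed.

(** A Bernoulli inequality: the product of the successive ratios is at least one minus the sum of
    their defects. Over at most [Q] steps this sum is at most [1 / 9], whence the factor [8 / 9]
    below. *)
Lemma tail_weight_ge_sum i n : (i <= n)%N ->
  a n * (1 - \sum_(i <= k < n) (1 - a k / a k.+1)) <= a i.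
Proof.
elim: n => [|n ih]; first by rewrite leqn0 => /eqP ->; rewrite big_geq// subr0 mulr1.
rewrite leq_eqVlt => /orP[/eqP ->|]; first by rewrite big_geq// subr0 mulr1.
rewrite ltnS => le_in; apply: le_trans (ih le_in); rewrite big_nat_recr//=.
have := tail_sum_ge0 i n; have := weight_nondecreasing n; have := weight_gt0 n.+1.
set S := \sum_(_ <= _ < _) _ => an1 ann S0.
rewrite (_ : _ * _ = a n - a n.+1 * S); last by field; rewrite gt_eqF.
rewrite mulrBr mulr1 lerD2l lerN2 ler_wpM2r//.
Qed.

Lemma tail_weight_ge i n : (i <= n)%N -> (n - i)%:R <= Q -> 8 / 9 * a n <= a i.
Proof.
move=> le_in niQ; apply: le_trans (tail_weight_ge_sum le_in).
rewrite mulrC ler_wpM2l ?(ltW (weight_gt0 _))//.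
by have := tail_sum_le le_in niQ; lra.
Qed.

(** A lower Riemann sum for the integral of [a0^2 / s^2] from [a0] to [a n]; [sum_increment_div_le]
    does the same for [1 / s]. *)
Lemma sum_increment_sqr_le n :
  \sum_(0 <= k < n) (a k.+1 - a k) * (a0 / a k.+1) ^+ 2 <= a0 - a0 ^+ 2 / a n.
Proof.
have a00 : 0 < a0 by case/andP: ha0.
rewrite (_ : a0 - _ = \sum_(0 <= k < n) (a0 ^+ 2 / a k - a0 ^+ 2 / a k.+1)).
  apply: ler_sum => k _; have := weight_nondecreasing k.
  have := weight_gt0 k; have := weight_gt0 k.+1 => p' p pp'.
  rewrite -mulrBr expr_div_n mulrCA ler_wpM2l ?sqr_ge0//.
  rewrite -[leRHS]mul1r -(mulfV (lt0r_neq0 p')).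
  rewrite (_ : _ / _ * (_ - _) = (a k.+1 - a k) / a k.+1 / a k); last first.
    by field; rewrite !gt_eqF.
  rewrite expr2 invfM mulrA ler_wpM2l ?mulr_ge0 ?invr_ge0 ?subr_ge0 ?(ltW p')//.
  by rewrite lef_pV2.
rewrite -[RHS]opprK -sumrN.
under eq_bigr do rewrite opprB.
rewrite (telescope_sumr (fun k => a0 ^+ 2 / a k))// ha_0.
by field; rewrite !gt_eqF ?weight_gt0.
Qed.

Lemma sum_increment_div_le n :
  \sum_(0 <= k < n) (a k.+1 - a k) / a k.+1 <= ln (a n / a0).
Proof.
have a00 : 0 < a0 by case/andP: ha0.
rewrite ln_div ?posrE ?weight_gt0//; apply: le_trans (sum_one_sub_ratio_le_ln n).
apply: ler_sum => k _.
by rewrite mulrBl mulfV ?gt_eqF ?weight_gt0.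
Qed.

(* The first summand is the squared optimization error, which decays like [a_k^-4],
   the second the noise, which decays like [a_k^-2]. *)
Lemma variance_recursion (D sigma kappa : R) k :
  kappa ^+ 2 = 5 * sigma ^+ 2 / (4 * (2 - 3 * gamma) * (Q + 1)) ->
  (1 - 4 / 3 * (eta k * a k)) * (((a0 / a k) ^+ 2 * D) ^+ 2 + (kappa / a k) ^+ 2)
    + 5 / 2 * eta k ^+ 2 * sigma ^+ 2 <=
  ((a0 / a k.+1) ^+ 2 * D) ^+ 2 + (kappa / a k.+1) ^+ 2.
Proof.
move=> kappaE; case/andP: hgamma => g0 g3.
have ak := weight_gt0 k; have ak' := weight_gt0 k.+1.
have r_ge := ratio_ge k; have r_le := ratio_le1 k.
have x0 : 0 < eta k * a k by rewrite mulr_gt0 ?step_gt0.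
have x6 := step_weight_le6 k; have xQ := step_weight_le k.
set r := a k / a k.+1 in r_ge r_le.
set x := eta k * a k in x0 x6 xQ *.
rewrite -mulrA -/x in r_ge.
have eE : eta k = x / a k by rewrite /x mulfK ?gt_eqF.
have -> : a0 / a k.+1 = a0 / a k * r by rewrite /r; field; rewrite !gt_eqF.
have -> : kappa / a k.+1 = kappa / a k * r by rewrite /r; field; rewrite !gt_eqF.
rewrite eE.
have p0 : 0 <= 1 - gamma * x by nra.
have r2 : 1 - 2 * gamma * x <= r ^+ 2.
  apply: (@le_trans _ _ ((1 - gamma * x) ^+ 2)); first by have := sqr_ge0 (gamma * x); nra.
  by rewrite ler_pXn2r ?nnegrE// (le_trans p0).
(* The assumption [gamma <= 1 / 3] enters here: the fourth power of the ratio loses at most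
   [4 gamma x], which the contraction [4 / 3 x] covers. *)
have r4 : 1 - 4 / 3 * x <= r ^+ 4.
  apply: (@le_trans _ _ ((1 - 2 * gamma * x) ^+ 2)).
    by have := sqr_ge0 (gamma * x); nra.
  rewrite (exprM r 2 2) ler_pXn2r ?nnegrE ?sqr_ge0//.
  nra.
have opt : (1 - 4 / 3 * x) * ((a0 / a k) ^+ 2 * D) ^+ 2 <= ((a0 / a k * r) ^+ 2 * D) ^+ 2.
  rewrite (_ : ((a0 / a k * r) ^+ 2 * D) ^+ 2 = r ^+ 4 * ((a0 / a k) ^+ 2 * D) ^+ 2); last by ring.
  by rewrite ler_wpM2r ?sqr_ge0.
rewrite mulrDr -addrA lerD//.
have iak : 0 <= (a k)^-1 ^+ 2 by exact: sqr_ge0.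
(* The margin [4 / 3 - 2 gamma] between contraction and loss absorbs the new noise; [kappa] is tuned
   so that equality holds at [x = 1 / (3 (Q + 1))], the largest value allowed. *)
have xs : 5 / 2 * x ^+ 2 * sigma ^+ 2 <= kappa ^+ 2 * (4 / 3 * x - 2 * gamma * x).
  have d1 : 0 < 2 - 3 * gamma by lra.
  rewrite kappaE.
  rewrite (_ : _ * (4 / 3 * x - _) = 5 / 2 * (x * (3 * (Q + 1))^-1) * sigma ^+ 2); last first.
    field.
    by rewrite !gt_eqF//.
  rewrite ler_wpM2r ?sqr_ge0// ler_wpM2l//; last by rewrite expr2 ler_wpM2l// ltW.
have k2 : kappa ^+ 2 * (1 - 2 * gamma * x) <= kappa ^+ 2 * r ^+ 2 by rewrite ler_wpM2l ?sqr_ge0.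
rewrite (_ : _ + _ = (kappa ^+ 2 * (1 - 4 / 3 * x) + 5 / 2 * x ^+ 2 * sigma ^+ 2)
  * (a k)^-1 ^+ 2); last by ring.
rewrite (_ : (kappa / a k * r) ^+ 2 = (kappa ^+ 2 * r ^+ 2) * (a k)^-1 ^+ 2); last by ring.
rewrite ler_wpM2r//; apply: le_trans k2; rewrite -lerBrDl; apply: le_trans xs _.
by rewrite le_eqVlt; apply/orP; left; apply/eqP; ring.
Qed.

End Weights.

(** * Mean-square bounds *)

Section L2.
Context {d : measure_display} {T : measurableType d} {R : realType}.
Variable P : probability T R.
Implicit Types f g : T -> R.

(** The integral is a supremum over simple functions below the integrand, hence monotone. This
    serves for integrands such as the squared residual, whose measurability is not established. *)
Lemma ge0_le_integral_nonmeasurable (f g : T -> \bar R) :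
  (forall t, 0 <= f t)%E -> (forall t, f t <= g t)%E ->
  (\int[P]_t f t <= \int[P]_t g t)%E.
Proof.
move=> f0 fg; have g0 t : (0 <= g t)%E by exact: le_trans (fg t).
rewrite !ge0_integralTE//; apply: le_ereal_sup => _ [h /= hf <-].
by exists h => //= t; exact: le_trans (fg t).
Qed.

(** A bound on the norm in [L^2], stated with squares; measurability is carried along so that
    Minkowski's inequality makes such bounds additive. *)
Definition L2_bound f (c : R) : Prop :=
  [/\ measurable_fun setT f, 0 <= c & (\int[P]_t (f t ^+ 2)%:E <= (c ^+ 2)%:E)%E].

Lemma poweR_half_le (x : \bar R) (c : R) : (0 <= x)%E -> 0 <= c ->
  (x `^ 2^-1 <= c%:E)%E <-> (x <= (c ^+ 2)%:E)%E.
Proof.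
move=> x0 c0; split=> h.
  have := @gt0_ler_poweR R 2 (ler0n _ _) (x `^ 2^-1)%E c%:E.
  rewrite !in_itv /= !leey !andbT poweR_ge0 lee_fin c0 => /(_ isT isT h).
  rewrite -poweRrM mulVf// poweRe1// => /le_trans; apply.
  by rewrite /= powR_mulrn.
have h2 : (0 : R) <= 2^-1 by rewrite invr_ge0.
have := @gt0_ler_poweR R 2^-1 h2 x (c ^+ 2)%:E.
rewrite !in_itv /= !leey !andbT x0 lee_fin sqr_ge0 => /(_ isT isT h) /le_trans; apply.
by rewrite /= -powR_mulrn// -powRrM mulfV// powRr1.
Qed.

Let LnormE f : ('N[P]_2%:E[EFin \o f] = (\int[P]_t (f t ^+ 2)%:E) `^ 2^-1)%E.
Proof.
rewrite unlock /=; congr (_ `^ _)%E; apply: eq_integral => t _ /=.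
by rewrite powR_mulrn// real_normK// num_real.
Qed.

Let L2_boundP f c : L2_bound f c <->
  [/\ measurable_fun setT f, 0 <= c & ('N[P]_2%:E[EFin \o f] <= c%:E)%E].
Proof.
have I0 : (0 <= \int[P]_t (f t ^+ 2)%:E)%E.
  by apply: integral_ge0 => t _; rewrite lee_fin sqr_ge0.
by split=> -[mf c0 h]; split => //; move: h; rewrite LnormE => /(poweR_half_le I0 c0).
Qed.

Lemma L2_bound_weaken f c c' : c <= c' -> L2_bound f c -> L2_bound f c'.
Proof.
move=> cc' [mf c0 h]; split => //; first exact: le_trans cc'.
by apply: le_trans h _; rewrite lee_fin ler_pXn2r ?nnegrE// (le_trans c0).
Qed.

Lemma L2_boundD f g c c' : L2_bound f c -> L2_bound g c' ->
  L2_bound (fun t => f t + g t) (c + c').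
Proof.
move=> /L2_boundP[mf c0 fc] /L2_boundP[mg c0' gc]; apply/L2_boundP; split.
- exact: measurable_funD.
- exact: addr_ge0.
have le12 : 1 <= 2 :> R by rewrite ler1n.
apply: le_trans (@minkowski_EFin _ _ _ P f g 2 mf mg le12) _.
by rewrite [leRHS]EFinD; exact: leeD.
Qed.

Lemma L2_boundZ f c k : 0 <= k -> L2_bound f c -> L2_bound (fun t => k * f t) (k * c).
Proof.
move=> k0 [mf c0 h]; split.
- exact: measurable_funM.
- exact: mulr_ge0.
under eq_integral do rewrite exprMn EFinM.
rewrite ge0_integralZl//; last 3 first.
- by apply/measurable_EFinP; exact: measurable_funX.
- by move=> t _; rewrite lee_fin sqr_ge0.
- by rewrite lee_fin sqr_ge0.
rewrite exprMn [leRHS]EFinM; apply: lee_wpmul2l => //.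
by rewrite lee_fin sqr_ge0.
Qed.

Lemma L2_bound_cst (k : R) : 0 <= k -> L2_bound (cst k) k.
Proof.
move=> k0; split => //.
apply: (@le_trans _ _ (\int[P]_t (cst (k ^+ 2)%:E t))%E) => //; rewrite integral_cst//.
by rewrite [X in (_ * X)%E](_ : _ = 1%E) ?mule1//; exact: probability_setT.
Qed.

Lemma L2_bound_sum (f : nat -> T -> R) (c : nat -> R) (i n : nat) :
  (forall k, (i <= k < n)%N -> L2_bound (f k) (c k)) ->
  L2_bound (fun t => \sum_(i <= k < n) f k t) (\sum_(i <= k < n) c k).
Proof.
elim: n => [|n ih] h.
  rewrite big_geq//; under eq_fun do rewrite big_geq//.
  exact: L2_bound_cst.
have [ni|ni] := leqP i n; last first.
  rewrite big_geq//; under eq_fun do rewrite big_geq//.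
  exact: L2_bound_cst.
rewrite big_nat_recr//=; under eq_fun do rewrite big_nat_recr//=.
apply: L2_boundD; last by apply: h; rewrite ni ltnSn.
by apply: ih => k /andP[ik kn]; apply: h; rewrite ik ltnW.
Qed.

End L2.

(** * Oracle noise evaluated at points determined by the past *)

Section Noise.
Context {R : realType} {H : normedModType R} (dot : {dot H for idfun})
  {dX dO : measure_display} {X : measurableType dX} {Omega : measurableType dO}
  (mu : probability X R) (P : probability Omega R).
Hypothesis hdot : induces_norm dot.
Variables (delta : X -> H -> H) (sigma : R).
Hypotheses (hdelta : measurable_random_map delta)
  (hmean : forall z : H, has_expectation mu (delta ^~ z) 0)
  (hvar : forall z : H,
     (\int[mu]_x (`|delta x z| ^+ 2)%:E <= (sigma ^+ 2)%:E)%E).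
Variables (I : choiceType) (xi : I -> {RV P >-> X}) (time : I -> nat).
Hypotheses (law : forall i B, measurable B -> P (xi i @^-1` B) = mu B)
  (indep : mutually_independent xi).

Definition past n := history xi [set i | (time i < n)%N].

Definition adapted n (Y : Omega -> H) := strongly_measurable (Y : past n -> H).

Lemma adapted_le n n' Y : (n <= n')%N -> adapted n Y -> adapted n' Y.
Proof.
move=> nn' aY; apply: (strongly_measurable_precomp _ aY).
by apply: measurable_history_sub => i /= /leq_trans; apply.
Qed.

Lemma adapted_strongly_measurable n (Y : Omega -> H) :
  adapted n Y -> strongly_measurable Y.
Proof.
by move=> aY; apply: (strongly_measurable_precomp _ aY); exact: measurable_to_history.
Qed.

(** [measurable_random_map] gives strong measurability on the product of the sample space and the
    past; it is pulled back along [w |-> (xi i w, w)]. *)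
Lemma adapted_noise i Z : adapted (time i) Z ->
  adapted (time i).+1 (fun w => delta (xi i w) (Z w)).
Proof.
move=> aZ; apply: (strongly_measurable_precomp
  (phi := fun w : past (time i).+1 => (xi i w, w : past (time i))) _ (hdelta aZ)).
apply: measurable_fun_pair; first by apply: measurable_history => /=.
by apply: measurable_history_sub => j /= /ltnW.
Qed.

(** The sample [xi i] is independent of the past that determines [W] and [Z]. Freezing that past
    leaves a centered noise added to a fixed vector, so the squares add. *)
Lemma integral_norm_sqr_noise i W Z c : adapted (time i) W -> adapted (time i) Z ->
  (\int[P]_w (`|W w + c *: delta (xi i w) (Z w)| ^+ 2)%:E <=
   \int[P]_w (`|W w| ^+ 2)%:E + (c ^+ 2 * sigma ^+ 2)%:E)%E.
Proof.
move=> aW aZ.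
pose f (p : X * past (time i)) : \bar R := (`|W p.2 + c *: delta p.1 (Z p.2)| ^+ 2)%:E.
have mf : measurable_fun setT f.
  apply/measurable_EFinP/measurable_funX/strongly_measurable_norm.
  apply: strongly_measurableD; last by apply: strongly_measurableZ; exact: hdelta.
  exact: strongly_measurable_precomp (@measurable_snd _ _ _ _) aW.
have ind B A : measurable B -> measurable A ->
    P (xi i @^-1` B `&` (id : Omega -> past (time i)) @^-1` A) =
    (mu B * P ((id : Omega -> past (time i)) @^-1` A))%E.
  move=> mB mA; rewrite -(law i mB).
  apply: (@history_independent _ _ _ _ _ _ _ xi [set j | (time j < time i)%N]) => //.
  by rewrite /= ltnn.
have f0 p : (0 <= f p)%E by rewrite lee_fin sqr_ge0.
have mid := @measurable_to_history _ _ _ _ _ _ _ xi [set j | (time j < time i)%N].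
have -> : (\int[P]_w (`|W w + c *: delta (xi i w) (Z w)| ^+ 2)%:E =
    \int[P]_w \int[mu]_x f (x, w))%E by exact: (ge0_integral_freeze mid ind mf f0).
have mW : measurable_fun setT (fun w => (`|W w| ^+ 2)%:E : \bar R).
  apply/measurable_EFinP/measurable_funX/strongly_measurable_norm.
  exact: adapted_strongly_measurable aW.
apply: (@le_trans _ _ (\int[P]_w ((`|W w| ^+ 2)%:E + (c ^+ 2 * sigma ^+ 2)%:E))%E).
  apply: ge0_le_integral_nonmeasurable => w.
    by apply: integral_ge0 => x _; rewrite lee_fin sqr_ge0.
  rewrite -EFinD; exact: (integral_norm_sqr_shift hdot (W w) c (hmean (Z w)) (hvar (Z w))).
rewrite ge0_integralD//; last by move=> w _; rewrite lee_fin mulr_ge0 ?sqr_ge0.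
rewrite integral_cst// [X in (_ * X)%E](_ : _ = 1%E) ?mule1//; exact: probability_setT.
Qed.

End Noise.

(** * The iteration *)

Section RRSEG.
Context {R : realType} {H : completeNormedModType R} (dot : {dot H for idfun})
  {dX dO : measure_display} {X : measurableType dX} {Omega : measurableType dO}
  (mu : probability X R) (P : probability Omega R).
Hypothesis hdot : induces_norm dot.
Variables (L D sigma : R) (F : H -> H) (A : H -> set H) (z0 zstar : H).
Hypotheses (hL : 0 < L) (hD : 0 < D) (hsigma : 0 <= sigma)
  (hFmono : monotone_map dot F) (hFlip : forall x y, `|F x - F y| <= L * `|x - y|)
  (hA : maximally_monotone dot A) (hsol : add_op F A zstar 0)
  (hdist : `|z0 - zstar| <= D).
Variable delta : X -> H -> H.
Hypotheses (hdelta : measurable_random_map delta)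
  (hmean : forall z : H, has_expectation mu (delta ^~ z) 0)
  (hvar : forall z : H,
     (\int[mu]_x (`|delta x z| ^+ 2)%:E <= (sigma ^+ 2)%:E)%E).
Variables (N : nat) (a0 gamma Q : R) (a eta lambda : nat -> R).
Hypotheses (ha0 : 0 < a0 < L) (hgamma : 0 < gamma <= 3^-1) (hQ1 : 1 <= Q)
  (ha_0 : a 0%N = a0)
  (heta : forall k, eta k = (3 * (L + Q * a k))^-1)
  (ha_S : forall k, a k.+1 = Num.min L (a k / (1 - gamma * eta k * a k)))
  (hlambda : forall k, lambda k = a k.+1 - a k).
Variables xi zeta : nat -> {RV P >-> X}.

Let sample (i : 'I_N + 'I_N) : {RV P >-> X} :=
  match i with inl k => xi k | inr k => zeta k end.

Hypotheses (law : forall i B, measurable B -> P (sample i @^-1` B) = mu B)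
  (indep : mutually_independent sample).

(* The samples are drawn in the order [xi_0, zeta_0, xi_1, zeta_1, ...]. *)
Let time (i : 'I_N + 'I_N) : nat :=
  match i with inl k => k.*2 | inr k => k.*2.+1 end.

Let adapted n (Y : Omega -> H) := adapted sample time n Y.

Let a_gt0 k : 0 < a k.
Proof. exact: (weight_gt0 hL ha0 hgamma hQ1 ha_0 heta ha_S). Qed.

Let eta_gt0 k : 0 < eta k.
Proof. exact: (step_gt0 hL ha0 hgamma hQ1 ha_0 heta ha_S). Qed.

Let lambda_ge0 k : 0 <= lambda k.
Proof.
by rewrite hlambda subr_ge0; exact: (weight_nondecreasing hL ha0 hgamma hQ1 ha_0 heta ha_S).
Qed.

Let aS k : a k + lambda k = a k.+1.
Proof. by rewrite hlambda addrC subrK. Qed.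

Let oracle (x : X) (z : H) := F z + delta x z.
Let state k w := rrseg A oracle z0 a0 eta lambda (xi ^~ w) (zeta ^~ w) k.
Let z k w : H := (state k w).1.2.
Let c k w : H := (state k w).2.
Let u k w := regularized_solution A F (a k) (c k w).
Let B k w := regularized F (a k) (c k w).
Let dxi k w := delta (xi k w) (z k w).
Let y k w := resolvent A (eta k) (z k w - eta k *: (B k w (z k w) + dxi k w)).
Let dzeta k w := delta (zeta k w) (y k w).
(** The next iterate before the noise of [zeta k] enters. It is known at time [2k + 1], when
    [zeta k] is still fresh. *)
Let zt k w := y k w - eta k *: (B k w (y k w) - B k w (z k w) - dxi k w).

Let stateE k w : (state k w).1.1 = a k.
Proof.
elim: k => [|k ih]; first by rewrite ha_0.
rewrite /state /=; move: ih; rewrite /state.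
by case: (rrseg _ _ _ _ _ _ _ _ k) => [[b v] e] /= ->.
Qed.

Let yE k w : y k w = resolvent A (eta k)
  (z k w - eta k *: (oracle (xi k w) (z k w) + a k *: (z k w - c k w))).
Proof.
by rewrite /y; congr (resolvent _ _ (_ - _ *: _)); rewrite /oracle /B /regularized addrAC.
Qed.

Let zS k w : z k.+1 w = zt k w - eta k *: dzeta k w.
Proof.
have -> : z k.+1 w = y k w - eta k *: (oracle (zeta k w) (y k w) + a k *: (y k w - c k w)
    - oracle (xi k w) (z k w) - a k *: (z k w - c k w)).
  rewrite yE /z /c; have := stateE k w; rewrite /state /=.
  by case: (rrseg _ _ _ _ _ _ _ _ k) => [[b v] e] /= ->.
rewrite /zt /oracle /dzeta /dxi /B /regularized.
by vector_ring hdot.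
Qed.

Let cS k w : c k.+1 w = (a k.+1)^-1 *: (a k *: c k w + lambda k *: z k.+1 w).
Proof.
rewrite -aS /z /c; have := stateE k w; rewrite /state /=.
by case: (rrseg _ _ _ _ _ _ _ _ k) => [[b v] e] /= ->.
Qed.

(** * Adaptedness of the iterates *)

Let adapted_comp n (f : H -> H) k Y : (forall x x', `|f x - f x'| <= k * `|x - x'|) ->
  adapted n Y -> adapted n (fun w => f (Y w)).
Proof.
by move=> fk; apply: strongly_measurable_comp; exact: (lipschitz1_continuous fk).
Qed.

Let adapted_F n Y : adapted n Y -> adapted n (fun w => F (Y w)).
Proof. exact: adapted_comp hFlip. Qed.

Let adapted_resolvent n k Y : adapted n Y -> adapted n (fun w => resolvent A (eta k) (Y w)).
Proof.
apply: (@adapted_comp _ _ 1) => x x'; rewrite mul1r.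
exact: (resolvent_nonexpansive hdot hA).
Qed.

Let adapted_solution n k : adapted n (c k) -> adapted n (u k).
Proof.
apply: (@adapted_comp _ _ 1) => x x'; rewrite mul1r.
exact: (regularized_solution_nonexpansive hdot hA hL hFmono hFlip).
Qed.

Let adapted_B n k Y : adapted n (c k) -> adapted n Y -> adapted n (fun w => B k w (Y w)).
Proof.
move=> ac aY; apply: strongly_measurableD; first exact: adapted_F.
by apply: strongly_measurableZ; exact: strongly_measurableB.
Qed.

Let adapted_dxi k Z : (k < N)%N -> adapted k.*2 Z ->
  adapted k.*2.+1 (fun w => delta (xi k w) (Z w)).
Proof. by move=> kN; exact: (adapted_noise hdelta (i := inl (Ordinal kN))). Qed.

Let adapted_dzeta k Z : (k < N)%N -> adapted k.*2.+1 Z ->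
  adapted k.*2.+2 (fun w => delta (zeta k w) (Z w)).
Proof. by move=> kN; exact: (adapted_noise hdelta (i := inr (Ordinal kN))). Qed.

Let adapted_zt k : (k < N)%N -> adapted k.*2 (z k) -> adapted k.*2 (c k) ->
  adapted k.*2.+1 (y k) /\ adapted k.*2.+1 (zt k).
Proof.
move=> kN az ac; have le1 Y : adapted k.*2 Y -> adapted k.*2.+1 Y.
  by apply: adapted_le.
have ad : adapted k.*2.+1 (dxi k) by exact: adapted_dxi.
have aBz : adapted k.*2.+1 (fun w => B k w (z k w)) by apply: adapted_B; exact: le1.
have ay : adapted k.*2.+1 (y k).
  apply: adapted_resolvent; apply: strongly_measurableB; first exact: le1.
  by apply: strongly_measurableZ; exact: strongly_measurableD.
split => //; apply: strongly_measurableB => //; apply: strongly_measurableZ.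
apply: strongly_measurableB => //; apply: strongly_measurableB => //.
by apply: adapted_B => //; exact: le1.
Qed.

Let adapted_state k : (k <= N)%N -> adapted k.*2 (z k) /\ adapted k.*2 (c k).
Proof.
elim: k => [_|k ih kN]; first by split; exact: strongly_measurable_cst.
have [az ac] := ih (ltnW kN); have [ay azt] := adapted_zt kN az ac.
have az' : adapted k.+1.*2 (z k.+1).
  rewrite (funext (zS k)) doubleS; apply: strongly_measurableB.
    by apply: adapted_le azt.
  by apply: strongly_measurableZ; exact: adapted_dzeta.
split => //; rewrite (funext (cS k)); apply: strongly_measurableZ.
apply: strongly_measurableD; apply: strongly_measurableZ => //.
by apply: adapted_le ac; rewrite doubleS; do 2 apply: leqW.
Qed.

(** * Mean-square distance to the regularized solutions *)

Let kappa := sigma * Num.sqrt (5 / (4 * (2 - 3 * gamma) * (Q + 1))).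
(** The recursion propagates this sum of squares; [deviation] is the resulting bound on the norm,
    since a root of a sum of squares is at most the sum. *)
Let variance k := ((a0 / a k) ^+ 2 * D) ^+ 2 + (kappa / a k) ^+ 2.
Let deviation k := (a0 / a k) ^+ 2 * D + kappa / a k.
Let err k w := `|z k w - u k w|.
(** The new iterate is measured against the old solution, before the anchor is updated. *)
Let err' k w := `|z k.+1 w - u k w|.

Let kappa_ge0 : 0 <= kappa. Proof. by rewrite mulr_ge0 ?sqrtr_ge0. Qed.

Let kappa_sqr : kappa ^+ 2 = 5 * sigma ^+ 2 / (4 * (2 - 3 * gamma) * (Q + 1)).
Proof.
have g : 0 <= 2 - 3 * gamma by case/andP: hgamma; lra.
have q : 0 <= Q + 1 by have := hQ1; lra.
by rewrite exprMn sqr_sqrtr ?divr_ge0 ?mulr_ge0//; ring.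
Qed.

Let uS k w : u k.+1 w = regularized_solution A F (a k + lambda k)
  ((a k + lambda k)^-1 *: (a k *: c k w + lambda k *: z k.+1 w)).
Proof. by rewrite /u cS aS. Qed.

Let err_le k w : err k.+1 w <= err' k w.
Proof.
rewrite /err /err' distrC (distrC (z _ _)) uS.
exact: (update_solution_closer hdot hA hL hFmono hFlip).
Qed.

Let solution_dist k w : `|u k.+1 w - u k w| <= lambda k / a k.+1 * err' k w.
Proof.
rewrite /err' (distrC (z _ _)) uS -[in leRHS]aS.
exact: (update_solution_dist hdot hA hL hFmono hFlip).
Qed.

Let anchor_step k w :
  a k.+1 * `|u k.+1 w - c k.+1 w| <= a k * `|u k w - c k w| + lambda k * err' k w.
Proof.
rewrite /err' (distrC (z _ _)) uS cS -aS.
exact: (update_anchor_dist hdot hA hL hFmono hFlip).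
Qed.

Let anchor_dist n w : a n * `|u n w - c n w| <=
  a0 * D + \sum_(0 <= k < n) lambda k * err' k w.
Proof.
elim: n => [|n ih].
  rewrite big_geq// addr0 ha_0 ler_wpM2l//; first by case/andP: ha0 => /ltW.
  apply: le_trans hdist; exact: (regularized_solution_dist hdot hA hL hFmono hFlip).
rewrite big_nat_recr//= addrA; apply: le_trans (anchor_step n w) _.
by rewrite lerD2r.
Qed.

Let measurable_err k : (k <= N)%N -> measurable_fun setT (err k).
Proof.
move=> kN; have [az ac] := adapted_state kN.
apply: strongly_measurable_norm.
apply: (@adapted_strongly_measurable _ _ _ _ _ _ _ _ sample time k.*2).
by apply: strongly_measurableB => //; exact: adapted_solution.
Qed.

Let measurable_err' k : (k < N)%N -> measurable_fun setT (err' k).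
Proof.
move=> kN; have [az _] := adapted_state kN; have [_ ac] := adapted_state (ltnW kN).
apply: strongly_measurable_norm.
apply: (@adapted_strongly_measurable _ _ _ _ _ _ _ _ sample time k.+1.*2).
apply: strongly_measurableB => //; apply: adapted_solution; apply: adapted_le ac.
by rewrite leq_double.
Qed.

Let noise_variance k : (k < N)%N ->
  (\int[P]_w (`|dxi k w| ^+ 2)%:E <= (sigma ^+ 2)%:E)%E.
Proof.
move=> kN; have [az _] := adapted_state (ltnW kN).
have a00 : adapted k.*2 (cst 0) by exact: strongly_measurable_cst.
have := integral_norm_sqr_noise hdot hdelta hmean hvar law indep
  (i := inl (Ordinal kN)) 1 a00 az.
under eq_integral do rewrite add0r scale1r.
move=> /le_trans; apply.
rewrite expr1n mul1r [X in (X + _)%E](_ : _ = 0%E) ?add0e//.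
by apply: integral0_eq => w _; rewrite normr0 expr0n.
Qed.

(** The coefficient [5 / 2] is [3 / 2] from the noise of [xi k] in [fbf_step] plus [1] from the
    orthogonal noise of [zeta k]. *)
Let variance_step k (v : R) : (k < N)%N ->
  (\int[P]_w (err k w ^+ 2)%:E <= v%:E)%E ->
  (\int[P]_w (err' k w ^+ 2)%:E <=
   ((1 - 4 / 3 * (eta k * a k)) * v + 5 / 2 * eta k ^+ 2 * sigma ^+ 2)%:E)%E.
Proof.
move=> kN vk.
have [az ac] := adapted_state (ltnW kN); have [ay azt] := adapted_zt kN az ac.
have aW : adapted k.*2.+1 (fun w => zt k w - u k w).
  by apply: strongly_measurableB => //; apply: adapted_solution; exact: adapted_le ac.
have -> : (\int[P]_w (err' k w ^+ 2)%:E =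
    \int[P]_w (`|(zt k w - u k w) + (- eta k) *: delta (zeta k w) (y k w)| ^+ 2)%:E)%E.
  by apply: eq_integral => w _; rewrite /err' zS scaleNr addrAC.
apply: le_trans (integral_norm_sqr_noise hdot hdelta hmean hvar law indep
  (i := inr (Ordinal kN)) (- eta k) aW ay) _.
have x6 := step_weight_le6 hL ha0 hgamma hQ1 ha_0 heta ha_S k.
have q0 : 0 <= 1 - 4 / 3 * (eta k * a k) by lra.
have e0 : 0 <= 3 / 2 * eta k ^+ 2 by rewrite mulr_ge0 ?sqr_ge0.
rewrite (_ : _ + _ = ((1 - 4 / 3 * (eta k * a k)) * v + 3 / 2 * eta k ^+ 2 * sigma ^+ 2)
   + (- eta k) ^+ 2 * sigma ^+ 2); last by field.
rewrite [leRHS]EFinD leeD2r//.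
apply: (@le_trans _ _ (\int[P]_w ((1 - 4 / 3 * (eta k * a k))%:E * (err k w ^+ 2)%:E
    + (3 / 2 * eta k ^+ 2)%:E * (`|dxi k w| ^+ 2)%:E))%E).
  apply: ge0_le_integral_nonmeasurable => w; first by rewrite lee_fin sqr_ge0.
  rewrite -!EFinM -EFinD lee_fin.
  apply: (fbf_step hdot hA (l := L + a k)) => //.
  - exact: ltW.
  - exact: (step_lipschitz_le hL ha0 hgamma hQ1 ha_0 heta ha_S).
  - move=> x x'; exact: regularized_strongly_monotone.
  - move=> x x'; apply: regularized_lipschitz => //; exact: ltW.
  - exact: (regularized_solution_graph hdot hA hL hFmono hFlip).
have mdxi : measurable_fun setT (fun w => (`|dxi k w| ^+ 2)%:E).
  apply/measurable_EFinP/measurable_funX/strongly_measurable_norm.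
  apply: (@adapted_strongly_measurable _ _ _ _ _ _ _ _ sample time k.*2.+1).
  exact: adapted_dxi.
have merr : measurable_fun setT (fun w => (err k w ^+ 2)%:E).
  by apply/measurable_EFinP/measurable_funX/measurable_err/ltnW.
rewrite ge0_integralD//; last 4 first.
- by move=> w _; rewrite -EFinM lee_fin mulr_ge0// sqr_ge0.
- exact: measurable_funeM.
- by move=> w _; rewrite -EFinM lee_fin mulr_ge0// sqr_ge0.
- exact: measurable_funeM.
rewrite !ge0_integralZl//; try by move=> w _; rewrite lee_fin sqr_ge0.
rewrite [leRHS]EFinD (EFinM _ v) (EFinM (3 / 2 * eta k ^+ 2)).
by apply: leeD; apply: lee_wpmul2l => //; exact: noise_variance.
Qed.

Let err_variance k : (k <= N)%N -> (\int[P]_w (err k w ^+ 2)%:E <= (variance k)%:E)%E.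
Proof.
elim: k => [_|k ih kN].
  have [_ _ hcst] := L2_bound_cst P (ltW hD).
  apply: (@le_trans _ _ (D ^+ 2)%:E).
    apply: le_trans hcst; apply: ge0_le_integral_nonmeasurable => w; rewrite lee_fin ?sqr_ge0//.
    rewrite /err distrC ler_pXn2r ?nnegrE ?(ltW hD)//.
    apply: le_trans hdist; exact: (regularized_solution_dist hdot hA hL hFmono hFlip).
  rewrite lee_fin /variance ha_0 divff ?gt_eqF//; last by case/andP: ha0.
  by rewrite expr1n mul1r lerDl sqr_ge0.
apply: (@le_trans _ _ (\int[P]_w (err' k w ^+ 2)%:E)%E).
  apply: ge0_le_integral_nonmeasurable => w; rewrite lee_fin ?sqr_ge0//.
  by apply: lerXn2r (err_le k w); rewrite nnegrE normr_ge0.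
apply: le_trans (variance_step kN (ih (ltnW kN))) _; rewrite lee_fin.
exact: (variance_recursion hL ha0 hgamma hQ1 ha_0 heta ha_S).
Qed.

Let variance_le k : variance k <= deviation k ^+ 2.
Proof.
have h1 : 0 <= (a0 / a k) ^+ 2 * D by rewrite mulr_ge0 ?sqr_ge0// ltW.
have h2 : 0 <= kappa / a k by rewrite divr_ge0// ltW.
by rewrite /variance /deviation sqrrD lerD2r lerDl mulrn_wge0// mulr_ge0.
Qed.

Let deviation_ge0 k : 0 <= deviation k.
Proof.
exact: addr_ge0 (mulr_ge0 (sqr_ge0 _) (ltW hD)) (divr_ge0 kappa_ge0 (ltW (a_gt0 k))).
Qed.

Let err_bound k : (k <= N)%N -> L2_bound P (err k) (deviation k).
Proof.
move=> kN; split; [exact: measurable_err|exact: deviation_ge0|].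
by apply: le_trans (err_variance kN) _; rewrite lee_fin.
Qed.

(** The index [k.+1] is already reached at the old solution: the variance recursion concerns the
    step alone, and moving to the new solution only decreases the error. *)
Let err'_bound k : (k < N)%N -> L2_bound P (err' k) (deviation k.+1).
Proof.
move=> kN; split; [exact: measurable_err'|exact: deviation_ge0|].
apply: le_trans (variance_step kN (err_variance (ltnW kN))) _; rewrite lee_fin.
apply: le_trans (variance_le k.+1).
exact: (variance_recursion hL ha0 hgamma hQ1 ha_0 heta ha_S).
Qed.

(** * The averaging window and the output residual *)

Hypotheses (hN : (2 <= N)%N) (hQ : Q = Qparam L gamma N a0).
Let m := Num.truncn (Num.min Q N%:R).

Let m_gt0 : (0 < m)%N.
Proof. by rewrite truncn_gt0 le_min hQ1 ler1n ltnW. Qed.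

Let m_le : m%:R <= Num.min Q N%:R.
Proof. by rewrite truncn_le le_min ler0n (le_trans ler01 hQ1). Qed.

Let m_leN : (m <= N)%N.
Proof. by rewrite -(ler_nat R) (le_trans m_le)// ge_min lexx orbT. Qed.

Let m_leQ : m%:R <= Q. Proof. by rewrite (le_trans m_le)// ge_min lexx. Qed.

Let a0_gt0 : 0 < a0. Proof. by case/andP: ha0. Qed.

Let aN : a N = L.
Proof. exact: (weight_max hL ha0 hgamma hQ1 ha_0 heta ha_S). Qed.

Let tail_window k : (N - m <= k)%N -> (k <= N)%N -> (N - k)%:R <= Q.
Proof.
move=> mk kN; apply: le_trans m_leQ; rewrite ler_nat.
by rewrite leq_subLR addnC -leq_subLR.
Qed.

Let deviationN : deviation N = (a0 / L) ^+ 2 * D + kappa / L.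
Proof. by rewrite /deviation aN. Qed.

Let deviation_tail k : (N - m <= k)%N -> (k <= N)%N ->
  deviation k <= 81 / 64 * ((a0 / L) ^+ 2 * D) + 9 / 8 * (kappa / L).
Proof.
move=> mk kN.
have := tail_weight_ge hL ha0 hgamma hQ1 ha_0 heta ha_S kN (tail_window mk kN).
rewrite aN => aL.
have ia : (a k)^-1 <= 9 / 8 * L^-1.
  rewrite (_ : 9 / 8 * L^-1 = (8 / 9 * L)^-1); last by field; rewrite gt_eqF.
  by rewrite lef_pV2 ?posrE// mulr_gt0.
have iL : 0 < L^-1 by rewrite invr_gt0.
have ia0 : 0 <= (a k)^-1 by rewrite invr_ge0 ltW.
apply: lerD; last by rewrite mulrCA ler_wpM2l.
rewrite mulrA ler_wpM2r ?(ltW hD)//.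
rewrite (_ : 81 / 64 * _ = (a0 * (9 / 8 * L^-1)) ^+ 2); last by field; rewrite gt_eqF.
by rewrite ler_pXn2r ?nnegrE ?mulr_ge0 ?(ltW a0_gt0) ?(ltW iL)// ler_wpM2l ?(ltW a0_gt0).
Qed.

Let solution_dist_tail i n w : (i <= n)%N ->
  `|u i w - u n w| <= \sum_(i <= j < n) lambda j / a j.+1 * err' j w.
Proof.
elim: n => [|n ih]; first by rewrite leqn0 => /eqP ->; rewrite subrr normr0 big_geq.
rewrite leq_eqVlt => /orP[/eqP ->|]; first by rewrite subrr normr0 big_geq.
rewrite ltnS => le_in; rewrite big_nat_recr//=.
apply: le_trans (ler_distD (u n w) _ _) _; apply: lerD; first exact: ih.
by rewrite distrC; exact: solution_dist.
Qed.

(** Bounds the distance from [z k] to [z N] by the path through [u k] and [u N]. *)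
Let drift k w :=
  err k w + (\sum_(k <= j < N) lambda j / a j.+1 * err' j w + err N w).

Let drift_ge k w : (k <= N)%N -> `|z k w - z N w| <= drift k w.
Proof.
move=> kN; apply: le_trans (ler_distD (u k w) _ _) _; rewrite /drift lerD2l.
apply: le_trans (ler_distD (u N w) _ _) _; rewrite (distrC _ (z N w)) lerD2r.
exact: solution_dist_tail.
Qed.

Let step_ratio_ge0 j : 0 <= lambda j / a j.+1.
Proof. by rewrite divr_ge0// ltW. Qed.

Let step_ratioE j : lambda j / a j.+1 = 1 - a j / a j.+1.
Proof. by rewrite hlambda mulrBl mulfV// gt_eqF. Qed.

(** The tail bound is used once for [err k] and once, with weight [1 / 9], for the motion of the
    solutions; [err N] adds one. Thus [81/64 * 10/9 + 1 = 77/32] and [9/8 * 10/9 + 1 = 9/4]. *)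
Let drift_bound k : (N - m <= k)%N -> (k <= N)%N ->
  L2_bound P (drift k) (77 / 32 * ((a0 / L) ^+ 2 * D) + 9 / 4 * (kappa / L)).
Proof.
move=> mk kN.
set b := 81 / 64 * ((a0 / L) ^+ 2 * D) + 9 / 8 * (kappa / L).
have b0 : 0 <= b by exact: le_trans (deviation_ge0 k) (deviation_tail mk kN).
have tb : L2_bound P (fun w => \sum_(k <= j < N) lambda j / a j.+1 * err' j w) (9^-1 * b).
  apply: (@L2_bound_weaken _ _ _ _ _ (\sum_(k <= j < N) lambda j / a j.+1 * b)).
    rewrite -mulr_suml ler_wpM2r//.
    under eq_bigr do rewrite step_ratioE.
    exact: (tail_sum_le hL ha0 hgamma hQ1 ha_0 heta ha_S kN (tail_window mk kN)).
  apply: L2_bound_sum => j /andP[kj jN]; apply: L2_boundZ => //.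
  apply: L2_bound_weaken (err'_bound jN); apply: deviation_tail => //.
  exact: leq_trans mk (leqW kj).
have := L2_boundD (err_bound kN) (L2_boundD tb (err_bound (leqnn N))).
apply: L2_bound_weaken; rewrite deviationN.
by have := deviation_tail mk kN; rewrite /b; lra.
Qed.

Let noise_sum n w := \sum_(N - m <= k < n) dxi k w.

(** The summands are martingale differences: each new noise is centered given the partial sum, so
    the variances add up. *)
Let noise_sum_variance n : (N - m <= n)%N -> (n <= N)%N ->
  adapted n.*2 (noise_sum n) /\
  (\int[P]_w (`|noise_sum n w| ^+ 2)%:E <= ((n - (N - m))%:R * sigma ^+ 2)%:E)%E.
Proof.
elim: n => [|n ih]; [rewrite leqn0 => /eqP mN _|].
  rewrite mN /noise_sum; under eq_fun do rewrite big_geq//.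
  split; first exact: strongly_measurable_cst.
  rewrite mul0r le_eqVlt; apply/orP; left; apply/eqP.
  by apply: integral0_eq => w _; rewrite big_geq// normr0 expr0n.
rewrite leq_eqVlt => /orP[/eqP <- _|].
  rewrite /noise_sum; under eq_fun do rewrite big_geq//.
  split; first exact: strongly_measurable_cst.
  rewrite subnn mul0r le_eqVlt; apply/orP; left; apply/eqP.
  by apply: integral0_eq => w _; rewrite big_geq// normr0 expr0n.
rewrite ltnS => mn nN; have [aS' vS] := ih mn (ltnW nN).
have [az _] := adapted_state (ltnW nN).
have E w : noise_sum n.+1 w = noise_sum n w + 1 *: delta (xi n w) (z n w).
  by rewrite /noise_sum big_nat_recr//= scale1r.
split.
  rewrite (funext E); apply: strongly_measurableD.
    by apply: adapted_le aS'; rewrite leq_double.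
  apply: strongly_measurableZ; apply: (@adapted_le _ _ _ _ _ _ _ _ _ _ n.*2.+1) => //.
  exact: adapted_dxi.
under eq_integral do rewrite E.
apply: le_trans (integral_norm_sqr_noise hdot hdelta hmean hvar law indep
  (i := inl (Ordinal nN)) 1 aS' az) _.
rewrite subSn// -natr1 mulrDl mul1r expr1n mul1r [leRHS]EFinD.
exact: leeD.
Qed.

Let noise_sum_bound : L2_bound P (fun w => `|noise_sum N w|) (sigma * Num.sqrt m%:R).
Proof.
have [aS' vS] := noise_sum_variance (leq_subr _ _) (leqnn N).
split.
- apply: strongly_measurable_norm.
  exact: (@adapted_strongly_measurable _ _ _ _ _ _ _ _ sample time N.*2).
- by rewrite mulr_ge0// sqrtr_ge0.
- by rewrite exprMn sqr_sqrtr// mulrC -[X in (X%:R * _)%:E](subKn m_leN).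
Qed.

Let anchor_bound : L2_bound P (fun w => L^-1 * (a0 * D + \sum_(0 <= k < N) lambda k * err' k w))
  (L^-1 * (a0 * D + ((a0 - a0 ^+ 2 / L) * D + kappa * ln (L / a0)))).
Proof.
apply: L2_boundZ; first by rewrite invr_ge0 ltW.
apply: L2_boundD; first by apply: L2_bound_cst; rewrite mulr_ge0// ltW.
apply: (@L2_bound_weaken _ _ _ _ _ (\sum_(0 <= k < N) lambda k * deviation k.+1)).
  rewrite (_ : \sum_(_ <= _ < _) _ =
    (\sum_(0 <= k < N) (a k.+1 - a k) * (a0 / a k.+1) ^+ 2) * D +
    kappa * \sum_(0 <= k < N) (a k.+1 - a k) / a k.+1); last first.
    rewrite mulr_suml mulr_sumr -big_split/=; apply: eq_bigr => k _.
    by rewrite hlambda /deviation; ring.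
  rewrite -aN; apply: lerD.
    rewrite ler_wpM2r ?(ltW hD)//.
    exact: (sum_increment_sqr_le hL ha0 hgamma hQ1 ha_0 heta ha_S).
  rewrite ler_wpM2l//.
  exact: (sum_increment_div_le hL ha0 hgamma hQ1 ha_0 heta ha_S).
apply: L2_bound_sum => k /andP[_ kN]; apply: L2_boundZ => //.
exact: err'_bound.
Qed.

Let Fbar w := m%:R^-1 *: \sum_(N - m <= k < N) oracle (xi k w) (z k w).

Let zhat w := resolvent A L^-1 (z N w - L^-1 *: Fbar w).

(** A pointwise majorant of the residual: last-iterate error, drift within the average, averaged
    noise, and anchor distance. *)
Let bound w := Num.sqrt 2 * L * ((Num.sqrt 2 * err N w +
    (m%:R^-1 * (\sum_(N - m <= k < N) drift k w) + (L * m%:R)^-1 * `|noise_sum N w|)) +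
  L^-1 * (a0 * D + \sum_(0 <= k < N) lambda k * err' k w)).

Let Fbar_dist w : `|F (z N w) - Fbar w| <=
  m%:R^-1 * (L * \sum_(N - m <= k < N) drift k w) + m%:R^-1 * `|noise_sum N w|.
Proof.
have m0 : 0 < m%:R :> R by rewrite ltr0n.
have -> : F (z N w) - Fbar w = m%:R^-1 *: (\sum_(N - m <= k < N) (F (z N w) - F (z k w))
    - noise_sum N w).
  rewrite /Fbar (_ : \sum_(_ <= _ < _) oracle _ _ =
    \sum_(N - m <= k < N) F (z k w) + noise_sum N w); last by rewrite -big_split.
  rewrite sumrB sumr_const_nat subKn// -[F (z N w) *+ m]scaler_nat.
  move: (m%:R : R) m0 (\sum_(_ <= _ < _) _) => M M0 S.
  by apply: (dot_ext hdot) => v; rewrite !dotE; field; rewrite gt_eqF.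
rewrite normrZ gtr0_norm ?invr_gt0// -mulrDr ler_wpM2l ?invr_ge0 ?(ltW m0)//.
apply: le_trans (ler_normB _ _) _; rewrite lerD2r.
apply: le_trans (ler_norm_sum _ _ _) _; rewrite mulr_sumr !big_nat.
apply: ler_sum => k /andP[_ kN]; apply: le_trans (hFlip _ _) _.
by rewrite ler_wpM2l ?(ltW hL)// distrC drift_ge// ltnW.
Qed.

Let residual_le w :
  (residual F A (zhat w) <= (bound w)%:E)%E.
Proof.
have Au := regularized_solution_graph hdot hA hL hFmono hFlip (c N w) hL.
apply: le_trans (forward_backward_residual hdot hA hL hFmono hFlip _ Au) _.
rewrite lee_fin ler_wpM2l ?mulr_ge0 ?sqrtr_ge0 ?(ltW hL)//.
(* The residual estimate requires regularization weight exactly [L], which is where [a N = L] is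
   used. *)
have uE : regularized_solution A F L (c N w) = u N w by rewrite /u aN.
rewrite uE; apply: lerD; last first.
  by rewrite ler_pdivlMl//; have := anchor_dist N w; rewrite aN.
rewrite (_ : z N w - L^-1 *: Fbar w - (u N w - L^-1 *: F (u N w)) =
  ((z N w - L^-1 *: F (z N w)) - (u N w - L^-1 *: F (u N w))) +
  L^-1 *: (F (z N w) - Fbar w)); last by vector_ring hdot.
apply: le_trans (ler_normD _ _) _; apply: lerD.
  exact: (forward_lipschitz hdot hL hFmono hFlip).
rewrite normrZ gtr0_norm ?invr_gt0// ler_pdivrMl//.
apply: le_trans (Fbar_dist w) _; rewrite le_eqVlt; apply/orP; left; apply/eqP.
by field; rewrite !gt_eqF// ltr0n.
Qed.

Let final : R := Num.sqrt 2 * L * D *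
      (2 * (a0 / L) + (Num.sqrt 2 - 1 + 77 / 32) * (a0 / L) ^+ 2)
    + Num.sqrt 2 * sigma / Num.sqrt m%:R
    + sigma * Num.sqrt (5 / (2 * (2 - 3 * gamma) * (Q + 1)))
        * (ln (L / a0) + Num.sqrt 2 + 9 / 4).

(** In the coefficient of [(a0 / L)^2], [sqrt 2] comes from [err N], [- 1] from the anchor and
    [77/32] from the drift; likewise [sqrt 2], the logarithm and [9/4] in the last noise term. *)
Let bound_L2 : L2_bound P bound final.
Proof.
have m0 : 0 < m%:R :> R by rewrite ltr0n.
have s0 : 0 < Num.sqrt m%:R :> R by rewrite sqrtr_gt0.
have r2 : 0 <= Num.sqrt 2 :> R := sqrtr_ge0 _.
have db : L2_bound P (fun w => \sum_(N - m <= k < N) drift k w)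
    (\sum_(N - m <= k < N) (77 / 32 * ((a0 / L) ^+ 2 * D) + 9 / 4 * (kappa / L))).
  by apply: L2_bound_sum => k /andP[mk kN]; apply: drift_bound => //; exact: ltnW.
have im0 : 0 <= m%:R^-1 :> R by rewrite invr_ge0 ltW.
have iLm0 : 0 <= (L * m%:R)^-1 by rewrite invr_ge0 mulr_ge0 ?ltW.
have rL0 : 0 <= Num.sqrt 2 * L by rewrite mulr_ge0 ?(ltW hL).
have := L2_boundZ rL0 (L2_boundD (L2_boundD (L2_boundZ r2 (err_bound (leqnn N)))
  (L2_boundD (L2_boundZ im0 db) (L2_boundZ iLm0 noise_sum_bound))) anchor_bound).
apply: L2_bound_weaken; rewrite le_eqVlt; apply/orP; left; apply/eqP.
rewrite sumr_const_nat subKn// deviationN /final.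
have -> : sigma * Num.sqrt (5 / (2 * (2 - 3 * gamma) * (Q + 1))) = Num.sqrt 2 * kappa.
  rewrite /kappa mulrCA -sqrtrM//; congr (_ * Num.sqrt _).
  have g : 0 < 2 - 3 * gamma by case/andP: hgamma; lra.
  have q : 0 < Q + 1 by have := hQ1; lra.
  by field; rewrite !gt_eqF.
rewrite -mulr_natl.
have -> : (L * m%:R)^-1 * (sigma * Num.sqrt m%:R) = L^-1 * (sigma / Num.sqrt m%:R).
  by rewrite -[X in (L * X)^-1](@sqr_sqrtr _ m%:R)//; field; rewrite !gt_eqF.
by field; rewrite !gt_eqF.
Qed.

Lemma rrseg_residual :
  ((\int[P]_w (residual F A (zhat w) ^+ 2)) `^ (2^-1)
   <= final%:E)%E.
Proof.
have [_ f0 h] := bound_L2.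
have res0 w : (0 <= residual F A (zhat w))%E.
  by apply: le_ereal_inf_tmp => _ [v _ <-]; rewrite lee_fin.
apply/poweR_half_le => //.
  by apply: integral_ge0 => w _; rewrite expe_ge0.
apply: le_trans h; apply: ge0_le_integral_nonmeasurable => w; first by rewrite expe_ge0.
have := residual_le w; have := res0 w.
(* The value [+oo] is excluded by the finite pointwise bound, and [-oo] by nonnegativity. *)
case: (residual _ _ _) => [r| |] //.
rewrite !lee_fin => r0 rb.
by rewrite -[leLHS]/(r ^+ 2) ler_pXn2r ?nnegrE// (le_trans r0).
Qed.

End RRSEG.

Theorem theorem6p1 (R : realType)
  (* the Hilbert space *)
  (H : completeNormedModType R) (dot : {dot H for idfun})
  (hdot : induces_norm dot)
  (* the inclusion problem *)
  (L D sigma : R) (hL : 0 < L) (hD : 0 < D) (hsigma : 0 <= sigma)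
  (F : H -> H) (hFmono : monotone_map dot F) (hFlip : L.-lipschitz F)
  (A : H -> set H) (hA : maximally_monotone dot A)
  (z0 : H)
  (hsol : exists zstar : H, add_op F A zstar 0 /\ `|z0 - zstar| <= D)
  (* the stochastic oracle F_x(z) = F(z) + delta_x(z), x distributed as mu *)
  (dX : measure_display) (X : measurableType dX) (mu : probability X R)
  (delta : X -> H -> H) (hdelta : measurable_random_map delta)
  (hmean : forall z : H, has_expectation mu (delta ^~ z) 0)
  (hvar : forall z : H,
     (\int[mu]_x (`|delta x z| ^+ 2)%:E <= (sigma ^+ 2)%:E)%E)
  (* the parameters *)
  (N : nat) (hN : (2 <= N)%N)
  (a0 gamma : R) (ha0 : 0 < a0 < L) (hgamma : 0 < gamma <= 3^-1)
  (Q : R) (hQ : Q = Qparam L gamma N a0) (hQ1 : 1 <= Q)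
  (a eta lambda : nat -> R)
  (ha_0 : a 0%N = a0)
  (heta : forall k, eta k = (3 * (L + Q * a k))^-1)
  (ha_S : forall k, a k.+1 = Num.min L (a k / (1 - gamma * eta k * a k)))
  (hlambda : forall k, lambda k = a k.+1 - a k)
  (* the samples xi_0, zeta_0, ..., xi_(N-1), zeta_(N-1) *)
  (dO : measure_display) (Omega : measurableType dO) (P : probability Omega R)
  (xi zeta : nat -> {RV P >-> X})
  (hlaw_xi : forall k, (k < N)%N -> forall B : set X, measurable B ->
     distribution P (xi k) B = mu B)
  (hlaw_zeta : forall k, (k < N)%N -> forall B : set X, measurable B ->
     distribution P (zeta k) B = mu B)
  (hindep : mutually_independent (fun i : 'I_N + 'I_N =>
     match i with inl k => xi k | inr k => zeta k end)) :
  a N = L /\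
  let Foracle (x : X) (z : H) := F z + delta x z in
  let z (k : nat) (w : Omega) :=
    rrseg_z A Foracle z0 a0 eta lambda (xi ^~ w) (zeta ^~ w) k in
  (* [Num.truncn] is the floor of a nonnegative number *)
  let m := Num.truncn (Num.min Q N%:R) in
  let Fbar (w : Omega) :=
    m%:R^-1 *: \sum_(N - m <= k < N) Foracle (xi k w) (z k w) in
  let zhat (w : Omega) := resolvent A L^-1 (z N w - L^-1 *: Fbar w) in
  ((\int[P]_w (residual F A (zhat w) ^+ 2)) `^ (2^-1) <=
   (Num.sqrt 2 * L * D *
      (2 * (a0 / L) + (Num.sqrt 2 - 1 + 77 / 32) * (a0 / L) ^+ 2)
    + Num.sqrt 2 * sigma / Num.sqrt m%:R
    + sigma * Num.sqrt (5 / (2 * (2 - 3 * gamma) * (Q + 1)))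
        * (ln (L / a0) + Num.sqrt 2 + 9 / 4))%:E)%E.
Proof.
case: hsol => zstar [hzstar hdist].
have hFlip' x y : `|F x - F y| <= L * `|x - y| by apply: (hFlip (x, y)).
split; first exact: (weight_max hL ha0 hgamma hQ1 ha_0 heta ha_S hQ).
move=> Foracle z m Fbar zhat.
have law (i : 'I_N + 'I_N) B : measurable B ->
    P ((match i with inl k => xi k | inr k => zeta k end : {RV P >-> X}) @^-1` B) = mu B.
  move=> mB; case: i => k; [exact: hlaw_xi|exact: hlaw_zeta].
exact: (rrseg_residual hdot hL hD hsigma hFmono hFlip' hA hzstar hdist hdelta hmean
  hvar ha0 hgamma hQ1 ha_0 heta ha_S hlambda law hindep hN hQ).
Qed.
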